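(* Let $\gamma\in(0,n)$ and let $Y$ be a rearrangement-invariant (r.i.) space over $\mathbb{R}^n$ such that $$\xi_{\frac n\gamma}\in Y(0,\infty), \tag{A}$$ where, for $\alpha>0$, $\xi_\alpha(t)=(t+1)^{\frac1\alpha-1}$, $t\in(0,\infty)$. Define the functional $\sigma$ by $$\sigma(f)=\|S_{\frac n\gamma}f^*\|_{Y(0,\infty)},\qquad f\in\mathcal{M}_+(\mathbb{R}^n),$$ where $S_{\frac n\gamma}$ is the weighted Stieltjes transform. Then $\sigma$ is an r.i. norm and $I_\gamma\colon X\to Y$, where $I_\gamma$ is the Riesz potential of order $\gamma$ and $X=X(\sigma)$. Moreover, $X$ is the optimal (biggest) r.i. space over $\mathbb{R}^n$ for which $I_\gamma\colon X\to Y$ holds, i.e. $Z\hookrightarrow X$ for every r.i. space $Z$ over $\mathbb{R}^n$ such that $I_\gamma\colon Z\to Y$. Conversely, if (A) is not true, then there does not exist an r.i. space $X$ over $\mathbb{R}^n$ for which $I_\gamma\colon X\to Y$ holds.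
   Context: Let $R$ be $\mathbb{R}^n$ or $(0,\infty)$ with Lebesgue measure $\mu$. $\mathcal{M}(R)$ is the set of measurable functions on $R$ with values in $[-\infty,\infty]$ and $\mathcal{M}_+(R)$ the set of nonnegative ones. For $f\in\mathcal{M}(R)$, $f^*(t)=\inf\{\lambda\in(0,\infty):\mu(\{|f|>\lambda\})\le t\}$. An r.i. norm on $R$ is a functional $\varrho\colon\mathcal{M}_+(R)\to[0,\infty]$ such that for all $f,g,f_j\in\mathcal{M}_+(R)$ and $\lambda\ge0$: (P1) $\varrho(f)=0$ iff $f=0$ a.e., $\varrho(\lambda f)=\lambda\varrho(f)$, $\varrho(f+g)\le\varrho(f)+\varrho(g)$; (P2) $f\le g$ a.e. implies $\varrho(f)\le\varrho(g)$; (P3) $f_j\nearrow f$ a.e. implies $\varrho(f_j)\nearrow\varrho(f)$; (P4) $\varrho(\chi_E)<\infty$ whenever $\mu(E)<\infty$; (P5) if $\mu(E)<\infty$, then $\int_Ef\,d\mu\le C_E\varrho(f)$ with a constant $C_E$ independent of $f$; (P6) $\varrho(f)=\varrho(g)$ whenever $f^*=g^*$. The r.i. space determined by $\varrho$ is $X(\varrho)=\{f\in\mathcal{M}(R):\varrho(|f|)<\infty\}$, with $\|f\|_{X(\varrho)}=\varrho(|f|)$. For an r.i. space $Y$ over $\mathbb{R}^n$, $Y(0,\infty)$ denotes its representation space, the unique r.i. space over $(0,\infty)$ with $\|f\|_Y=\|f^*\|_{Y(0,\infty)}$ for all $f$. $T\colon X\to Y$ means there is $C>0$ with $\|Tf\|_Y\le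 C\|f\|_X$ for all $f\in X$; $X\hookrightarrow Y$ means this for the identity operator. The Riesz potential of order $\gamma$ is $(I_\gamma f)(x)=\int_{\mathbb{R}^n}f(y)\phi(x-y)\,dy$, $x\in\mathbb{R}^n$, where $\phi(y)=c(\gamma)|y|^{\gamma-n}$ and $c(\gamma)=\Gamma\left(\frac{n-\gamma}{2}\right)\left(\pi^{\frac n2}2^\gamma\Gamma\left(\frac\gamma2\right)\right)^{-1}$. For $\alpha\in(1,\infty)$ the weighted Stieltjes transform of a nonnegative measurable $f$ on $(0,\infty)$ is $(S_\alpha f)(t)=t^{\frac1\alpha-1}\int_0^tf(s)\,ds+\int_t^\infty f(s)s^{\frac1\alpha-1}\,ds$, $t\in(0,\infty)$. *)

(* Defs.v *)
From HB Require Import structures.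
From mathcomp Require Import all_boot all_order all_algebra.
From mathcomp Require Import all_classical all_reals all_analysis.
From mathcomp Require Import measurable_realfun.

Set Implicit Arguments.
Unset Strict Implicit.
Unset Printing Implicit Defensive.

Import Order.TTheory GRing.Theory Num.Theory.
Import numFieldNormedType.Exports.

Local Open Scope classical_set_scope.
Local Open Scope ring_scope.
Local Open Scope ereal_scope.

Definition tcons (R : realType) (n : nat)
    (p : measurableTypeR R * n.-tuple (measurableTypeR R)) :
    n.+1.-tuple (measurableTypeR R) :=
  [the n.+1.-tuple (measurableTypeR R) of p.1 :: p.2].

Lemma measurable_tcons (R : realType) (n : nat) :
  measurable_fun [set: measurableTypeR R * n.-tuple (measurableTypeR R)]
    (@tcons R n).
Proof. exact: measurable_cons. Qed.

Section pushforward_tcons.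
Context (R : realType) (n : nat).
Context (mu : {sigma_finite_measure
  set (n.-tuple (measurableTypeR R)) -> \bar R}).

Definition prod_tcons : set (n.+1.-tuple (measurableTypeR R)) -> \bar R :=
  pushforward (@lebesgue_measure R \x mu) (@tcons R n).

Let mtcons := @measurable_tcons R n.

Let prod_tcons0 : prod_tcons set0 = 0.
Proof. by rewrite /prod_tcons /pushforward preimage_set0 measure0. Qed.

Let prod_tcons_ge0 A : 0 <= prod_tcons A.
Proof. exact: measure_ge0. Qed.

Let prod_tcons_sigma_additive : semi_sigma_additive prod_tcons.
Proof.
move=> F mF tF mUF; rewrite /prod_tcons /pushforward preimage_bigcup.
apply: measure_semi_sigma_additive.
- by move=> k; rewrite -[X in measurable X]setTI; exact: mtcons.
- apply/trivIsetP => /= i j _ _ ij; rewrite -preimage_setI.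
  by move/trivIsetP : tF => /(_ _ _ _ _ ij) ->//; rewrite preimage_set0.
- by rewrite -preimage_bigcup -[X in measurable X]setTI; exact: mtcons.
Qed.

HB.instance Definition _ := isMeasure.Build _ _ _ prod_tcons
  prod_tcons0 prod_tcons_ge0 prod_tcons_sigma_additive.

Lemma prod_tcons_sigma_finite : sigma_finite setT prod_tcons.
Proof.
have /sigma_finiteP[F [FT ndF mF]] := sigma_finiteT (@lebesgue_measure R).
have /sigma_finiteP[G [GT ndG mG]] := sigma_finiteT mu.
pose g (t : n.+1.-tuple (measurableTypeR R)) :
    measurableTypeR R * n.-tuple (measurableTypeR R) :=
  (thead t, [tuple of behead t]).
have mg : measurable_fun setT g.
  apply: measurable_fun_pair.
    exact: measurable_tnth.
  exact: measurable_behead.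
have gK : cancel (@tcons R n) g.
  by move=> [x t]; rewrite /g /tcons theadE; congr pair; apply/val_inj.
exists (fun k => g @^-1` (F k `*` G k)).
  apply/esym/seteqP; split => // t _.
  have : [set: measurableTypeR R] (g t).1 by [].
  rewrite FT => -[i _ Fi].
  have : [set: n.-tuple (measurableTypeR R)] (g t).2 by [].
  rewrite GT => -[j _ Gj].
  exists (maxn i j) => //; split.
    by move: (g t).1 Fi; exact/subsetPset/ndF/leq_maxl.
  by move: (g t).2 Gj; exact/subsetPset/ndG/leq_maxr.
move=> k; have [mFk Fkoo] := mF k; have [mGk Gkoo] := mG k; split.
  by rewrite -[X in measurable X]setTI; apply: mg => //; exact: measurableX.
rewrite /prod_tcons /pushforward.
have -> : @tcons R n @^-1` (g @^-1` (F k `*` G k)) = F k `*` G k.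
  by apply/seteqP; split => p; rewrite /preimage /mkset gK.
by rewrite product_measure1E// lte_mul_pinfty// ge0_fin_numE.
Qed.

HB.instance Definition _ :=
  Measure_isSigmaFinite.Build _ _ _ prod_tcons prod_tcons_sigma_finite.

End pushforward_tcons.

(* n-fold product of the one-dimensional Lebesgue measure, on the Borel sets *)
Fixpoint borel_lebesgue (R : realType) (n : nat) :
    {sigma_finite_measure set (n.-tuple (measurableTypeR R)) -> \bar R} :=
  match n with
  | 0 => \d_([tuple] : 0.-tuple (measurableTypeR R))
  | m.+1 => prod_tcons (borel_lebesgue R m)
  end.

(* R^n with the Lebesgue sigma-algebra, i.e. the completion of the Borel one *)
Definition euclid (R : realType) (n : nat) :=
  caratheodory_type ((borel_lebesgue R n)^*)%mu.

Definition lebesgue_euclid (R : realType) (n : nat) :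
    {measure set (euclid R n) -> \bar R} :=
  @completed_measure_extension _ _ _ (borel_lebesgue R n).

Definition line (R : realType) :=
  caratheodory_type ((wlength (@idfun R))^*)%mu.

Definition lebesgue_line (R : realType) : {measure set (line R) -> \bar R} :=
  completed_lebesgue_measure.

(* The measure space (0, oo) is the domain [halfline] of [line]: functions on
   it are total functions of which only the values on [halfline] matter. *)
Definition halfline (R : realType) : set (line R) := [set t | (0 < (t : R))%R].

Definition mplus (d : measure_display) (T : measurableType d) (R : realType)
    (D : set T) (f : T -> \bar R) : Prop :=
  measurable_fun D f /\ forall x, D x -> 0 <= f x.

(* nonincreasing rearrangement; [ereal_inf set0 = +oo] *)
Definition rearr (d : measure_display) (T : measurableType d) (R : realType)
    (mu : {measure set T -> \bar R}) (D : set T) (f : T -> \bar R)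
    (t : R) : \bar R :=
  ereal_inf [set l%:E | l in
    [set l : R | (0 < l)%R /\ mu (D `&` [set x | l%:E < `|f x|]) <= t%:E]].

Record ri_norm (d : measure_display) (T : measurableType d) (R : realType)
    (mu : {measure set T -> \bar R}) (D : set T)
    (rho : (T -> \bar R) -> \bar R) : Prop := {
  ri_ge0 : forall f, mplus D f -> 0 <= rho f ;
  ri_eq0 : forall f, mplus D f ->
    (rho f = 0 <-> {ae mu, forall x, D x -> f x = 0}) ;
  ri_scale : forall f (l : R), mplus D f -> (0 <= l)%R ->
    rho (fun x => l%:E * f x) = l%:E * rho f ;
  ri_triangle : forall f g, mplus D f -> mplus D g ->
    rho (fun x => f x + g x) <= rho f + rho g ;
  ri_mono : forall f g, mplus D f -> mplus D g ->
    {ae mu, forall x, D x -> f x <= g x} -> rho f <= rho g ;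
  ri_fatou : forall (f_ : nat -> T -> \bar R) f,
    (forall j, mplus D (f_ j)) -> mplus D f ->
    {ae mu, forall x, D x -> nondecreasing_seq (fun j => f_ j x) /\
                             f_ j x @[j --> \oo] --> f x} ->
    nondecreasing_seq (fun j => rho (f_ j)) /\
    rho (f_ j) @[j --> \oo] --> rho f ;
  ri_indic : forall E, measurable E -> E `<=` D -> mu E < +oo ->
    rho (fun x => (\1_E x)%:E) < +oo ;
  ri_local : forall E, measurable E -> E `<=` D -> mu E < +oo ->
    exists C : R, (0 < C)%R /\
      forall f, mplus D f -> \int[mu]_(x in E) f x <= C%:E * rho f ;
  ri_equimeas : forall f g, mplus D f -> mplus D g ->
    (forall t : R, (0 < t)%R -> rearr mu D f t = rearr mu D g t) ->
    rho f = rho g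
}.

Definition ri_space (d : measure_display) (T : measurableType d) (R : realType)
    (D : set T) (rho : (T -> \bar R) -> \bar R) (f : T -> \bar R) : Prop :=
  measurable_fun D f /\ rho (fun x => `|f x|) < +oo.

(* Measurability of [op f] is part of the meaning of its norm, because the
   axioms only constrain a norm on measurable functions. *)
Definition bounded_op (d : measure_display) (T : measurableType d)
    (R : realType) (D : set T) (rhoX rhoY : (T -> \bar R) -> \bar R)
    (op : (T -> \bar R) -> (T -> \bar R)) : Prop :=
  exists C : R, (0 < C)%R /\ forall f, ri_space D rhoX f ->
    measurable_fun D (op f) /\
    rhoY (fun x => `|op f x|) <= C%:E * rhoX (fun x => `|f x|).

Definition embedded (d : measure_display) (T : measurableType d)
    (R : realType) (D : set T) (rhoX rhoY : (T -> \bar R) -> \bar R) : Prop :=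
  bounded_op D rhoX rhoY id.

(* By the Luxemburg representation theorem such a [rho'] exists, and it is
   unique on the nonnegative measurable functions. *)
Definition representation_norm (R : realType) (n : nat)
    (rho : (euclid R n -> \bar R) -> \bar R)
    (rho' : (line R -> \bar R) -> \bar R) : Prop :=
  ri_norm (lebesgue_line R) (@halfline R) rho' /\
  forall f : euclid R n -> \bar R, measurable_fun setT f ->
    rho (fun x => `|f x|) = rho' (rearr (lebesgue_euclid R n) setT f).

Definition euler_gamma (R : realType) (a : R) : R :=
  (\int[@lebesgue_measure R]_(t in `]0%R, +oo[) (t `^ (a - 1) * expR (- t)))%R.

Definition enorm (R : realType) (n : nat) (y : n.-tuple R) : R :=
  Num.sqrt (\sum_(i < n) tnth y i ^+ 2).

Definition vsub (R : realType) (n : nat) (x y : n.-tuple R) : n.-tuple R :=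
  [tuple (tnth x i - tnth y i)%R | i < n].

Definition riesz_const (R : realType) (n : nat) (gamma : R) : R :=
  (euler_gamma ((n%:R - gamma) / 2) /
   (pi `^ (n%:R / 2) * 2 `^ gamma * euler_gamma (gamma / 2)))%R.

(* Since [0 `^ a = 0] for [a != 0], the kernel is 0 and not infinite at the
   origin, which is a null set (n >= 1 whenever 0 < gamma < n). *)
Definition riesz_kernel (R : realType) (n : nat) (gamma : R) (y : n.-tuple R) :
    R :=
  (riesz_const n gamma * enorm y `^ (gamma - n%:R))%R.

(* Where the positive and negative parts both have infinite integral, the
   library convention gives -oo; a finite norm confines this to a null set. *)
Definition riesz (R : realType) (n : nat) (gamma : R)
    (f : euclid R n -> \bar R) (x : euclid R n) : \bar R :=
  \int[lebesgue_euclid R n]_y (f y * (riesz_kernel gamma (vsub x y))%:E).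

Definition stieltjes (R : realType) (alpha : R) (f : line R -> \bar R)
    (t : line R) : \bar R :=
  ((t : R) `^ (alpha^-1 - 1))%:E *
    \int[lebesgue_line R]_(s in [set s | (0 < (s : R) < t)%R]) f s +
  \int[lebesgue_line R]_(s in [set s | ((t : R) < s)%R])
    (f s * ((s : R) `^ (alpha^-1 - 1))%:E).

Definition xi (R : realType) (alpha : R) (t : line R) : \bar R :=
  (((t : R) + 1) `^ (alpha^-1 - 1))%:E.

(* [rho'] is the norm of the representation space Y(0, oo) *)
Definition sigma_norm (R : realType) (n : nat) (gamma : R)
    (rho' : (line R -> \bar R) -> \bar R) (f : euclid R n -> \bar R) : \bar R :=
  rho' (stieltjes (n%:R / gamma) (rearr (lebesgue_euclid R n) setT f)).

(* Main.v *)
Require Import Defs.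
From HB Require Import structures.
From mathcomp Require Import all_boot all_order all_algebra.
From mathcomp Require Import all_classical all_reals all_analysis.
From mathcomp Require Import measurable_realfun.
From mathcomp Require Import ring lra.

Set Implicit Arguments.
Unset Strict Implicit.
Unset Printing Implicit Defensive.

Import Order.TTheory GRing.Theory Num.Theory.
Import numFieldNormedType.Exports.

Local Open Scope classical_set_scope.
Local Open Scope ring_scope.

(** Put a = gamma/n - 1, so that -1 < a < 0, and write f* for the nonincreasing
    rearrangement.  With alpha = n/gamma the transform is

      S u (t) = int_0^oo u(s) max(s, t)^a ds        ([stieltjesE]),

    and everything rests on a two-sided comparison of the potential with S f*.

    Upper bound, O'Neil's inequality ([rearr_riesz_le]): (I f)* <= C S f* for
    f >= 0.  Split f at the level lam = f*(t).  The potential of min(f, lam) is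
    at most C S f* (t) at every point, because int f g <= int f* g* and the
    rearrangement of the kernel is a multiple of s^a; the excess (f - lam)+ is
    integrable, and its potential exceeds C t^a int (f - lam)+ on a set of
    measure at most t only ([riesz_weak_type]).

    Lower bound ([stieltjes_le_riesz]): let gauge y be the volume of the cube
    centred at 0 with y on its boundary.  This map carries Lebesgue measure to
    Lebesgue measure on the half-line, hence F = u o gauge is equimeasurable with
    u when u is nonincreasing ([distr_gcomp]).  As |x - y| is at most a multiple
    of max(|x|, |y|), the kernel at x - y is at least B max(gauge x, gauge y)^a,
    and integrating over y gives I F >= B (S u) o gauge.

    The theorem follows.  The functional sigma f = || S f* || is an r.i. norm:
    the triangle inequality holds because S u depends on u only through the
    integrals of u over the intervals ]0, r[, and these are subadditive in f for
    u = f* ([below_rearrD]); condition (A) is used for characteristic functions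
    of sets of finite measure, whose transforms are bounded by a multiple of xi
    ([stieltjes_le_xi]).  The upper bound says that I is bounded from X(sigma)
    to Y.  If I is bounded from Z to Y, then for f in Z the function
    F = f* o gauge has the same norm in Z as f, and the lower bound gives
    B sigma(f) <= || I F ||_Y <= C || F ||_Z, which is optimality
    ([sigma_norm_optimal]).  Taken for the characteristic function f of the unit
    cube, whose transform S f* dominates xi, the same inequality shows that (A)
    holds as soon as some Z exists ([riesz_bounded_xi]).

    Integrals are compared by layer cakes throughout: int f g is the integral over
    l > 0 of the integrals of g over the sets {f > l} ([layer_cake]). *)

(** * The half-line and layer cakes *)

Local Open Scope ereal_scope.

Lemma lebesgue_measure_below (R : realType) (a : \bar R) : 0 <= a ->
  @lebesgue_measure R [set l | (0 < l)%R /\ l%:E < a] = a.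
Proof.
case: a => [r| |] //.
- rewrite lee_fin => r0.
  have -> : [set l | (0 < l)%R /\ l%:E < r%:E] = `]0%R, r[%classic.
    by apply/seteqP; split => l /=; rewrite in_itv/= lte_fin => /andP.
  by rewrite lebesgue_measure_itv/= lte_fin; case: ltP => // r0'; rewrite ?sube0//;
    congr (_%:E); apply/eqP; rewrite eq_le r0 r0'.
- move=> _; have -> : [set l | (0 < l)%R /\ l%:E < +oo :> \bar R] = `]0%R, +oo[%classic.
    by apply/seteqP; split => l /=; rewrite in_itv/= andbT ?ltry// => -[].
  by rewrite lebesgue_measure_itv/= ltry.
Qed.

Section line.
Context (R : realType).
Implicit Types (A : set R) (a : \bar R) (s t : R) (f : line R -> \bar R).

Lemma measurable_line A :
  measurable (A : set (measurableTypeR R)) -> measurable (A : set (line R)).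
Proof. exact: sub_caratheodory. Qed.

Lemma measurable_line_id : measurable_fun [set: line R] (fun s => (s : R)).
Proof. by move=> _ B mB; rewrite setTI; exact: measurable_line. Qed.

Lemma lebesgue_lineE A :
  lebesgue_line R (A : set (line R)) = @lebesgue_measure R A.
Proof. by []. Qed.

Lemma sigma_finite_line : sigma_finite setT (lebesgue_line R).
Proof. exact: (@sigma_finiteT _ _ _ (@completed_lebesgue_measure R)). Qed.

Definition below a : set (line R) := [set s | (0 < (s : R))%R /\ (s : R)%:E < a].

Lemma lebesgue_below a : 0 <= a -> lebesgue_line R (below a) = a.
Proof. by move=> a0; rewrite lebesgue_lineE; exact: lebesgue_measure_below. Qed.

Lemma measurable_downset (I : set (line R)) : I `<=` @halfline R ->
  (forall s t : R, (0 < s)%R -> (s <= t)%R -> I t -> I s) -> measurable I.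
Proof.
move=> I0 dI; apply: measurable_line; apply: is_interval_measurable.
move=> s t Is It u /andP[su ut]; apply: (dI u t) => //.
exact: lt_le_trans (I0 _ Is) su.
Qed.

Lemma measurable_below a : measurable (below a).
Proof.
apply: measurable_downset => [s []//|s t s0 st [t0 ta]]; split => //.
by rewrite (le_lt_trans _ ta)// lee_fin.
Qed.

Lemma measurable_halfline : measurable (@halfline R).
Proof. by apply: measurable_downset. Qed.

(** Up to its right endpoint, a downset of the half-line is determined by its
    measure: a point outside of it bounds it, a point inside bounds its measure
    from below. *)
Lemma downset_below (I : set (line R)) : I `<=` @halfline R ->
  (forall s t : R, (0 < s)%R -> (s <= t)%R -> I t -> I s) ->
  below (lebesgue_line R I) `<=` I /\
  forall s : R, I s -> s%:E <= lebesgue_line R I.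
Proof.
move=> I0 dI; have mI := measurable_downset I0 dI; split => [s [s0 sI]|s Is].
  apply: contrapT => nIs.
  suff : lebesgue_line R I <= s%:E by rewrite leNgt sI.
  rewrite -[leRHS]lebesgue_below; last by rewrite lee_fin ltW.
  apply: le_measure; rewrite ?inE//; first exact: measurable_below.
  move=> t It; split; first exact: I0.
  rewrite lte_fin ltNge; apply/negP => st; apply: nIs; exact: dI st It.
have s0 := I0 _ Is.
rewrite -[leLHS]lebesgue_below; last by rewrite lee_fin ltW.
apply: le_measure; rewrite ?inE//; first exact: measurable_below.
by move=> t [t0 ts]; apply: dI Is => //; rewrite ltW.
Qed.

Lemma measurable_fun_nonincreasing f :
  (forall s t : R, (0 < s)%R -> (s <= t)%R -> f t <= f s) ->
  measurable_fun (@halfline R) f.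
Proof.
move=> f_ni; apply: (measurability _ (ErealGenOInfty.measurableE R)) => //=.
move=> _ [_ [r ->] <-]; rewrite preimage_itvoy.
apply: measurable_downset => [s []//|s t s0 st [_ /= rt]]; split => //=.
exact: lt_le_trans rt (f_ni _ _ s0 st).
Qed.

End line.

(** Tonelli's theorem takes measures bundled with their sigma-finiteness; this
    alias of a measure carries the proof from which the bundle is inferred. *)
Definition with_sigma_finite d (T : measurableType d) (R : realType)
    (mu : {measure set T -> \bar R}) of sigma_finite setT mu :
  set T -> \bar R := mu.

Section with_sigma_finite.
Context d (T : measurableType d) (R : realType).
Variables (mu : {measure set T -> \bar R}) (smu : sigma_finite setT mu).

HB.instance Definition _ := Measure.on (with_sigma_finite smu).
HB.instance Definition _ :=
  Measure_isSigmaFinite.Build _ _ _ (with_sigma_finite smu) smu.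

End with_sigma_finite.

Section layer_cake.
Context d (T : measurableType d) (R : realType).
Variables (mu : {measure set T -> \bar R}) (smu : sigma_finite setT mu).

Section tonelli.
Context d' (T' : measurableType d').
Variables (nu : {measure set T' -> \bar R}) (snu : sigma_finite setT nu).
Variable f : T * T' -> \bar R.
Hypotheses (mf : measurable_fun setT f) (f0 : forall p, 0 <= f p).

Lemma tonelli :
  \int[mu]_x \int[nu]_y f (x, y) = \int[nu]_y \int[mu]_x f (x, y).
Proof.
pose m1 : {sigma_finite_measure set T -> \bar R} :=
  with_sigma_finite smu.
pose m2 : {sigma_finite_measure set T' -> \bar R} :=
  with_sigma_finite snu.
exact: (@fubini_tonelli _ _ _ _ _ m1 m2 f).
Qed.

Lemma measurable_partial_integral :
  measurable_fun setT (fun x => \int[nu]_y f (x, y)).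
Proof.
pose m2 : {sigma_finite_measure set T' -> \bar R} :=
  with_sigma_finite snu.
exact: (@measurable_fun_fubini_tonelli_F _ _ _ _ _ m2 f).
Qed.

End tonelli.

(** The number f x is the length of the interval ]0, f x[, so that the integral of
    f g is a double integral over the region under the graph of f; its sections at
    fixed height are the superlevel sets of f. *)
Lemma layer_cake (D : set T) (f g : T -> \bar R) : measurable D ->
  mplus D f -> mplus D g ->
  \int[mu]_(x in D) (f x * g x) =
  \int[lebesgue_line R]_(l in @halfline R)
     \int[mu]_(x in D `&` [set x | (l : R)%:E < f x]) g x.
Proof.
move=> mD [mf f0] [mg g0].
pose fD := f \_ D; pose gD := g \_ D.
have mfD : measurable_fun setT fD by apply/(measurable_restrictT _ _).1.
have mgD : measurable_fun setT gD by apply/(measurable_restrictT _ _).1.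
have fD0 x : 0 <= fD x by apply: erestrict_ge0.
have gD0 x : 0 <= gD x by apply: erestrict_ge0.
(* the region under the graph of f *)
pose A : set (T * line R) :=
  [set p | (0 < (p.2 : R))%R] `&` [set p | (p.2 : R)%:E < fD p.1].
have mA : measurable A.
  apply: measurableI.
  - have := @measurable_snd _ _ T (line R) measurableT _ (@measurable_halfline R).
    by rewrite setTI.
  - rewrite -[X in measurable X]setTI; apply: measurable_lte => //.
      apply/measurable_EFinP.
      exact: (measurableT_comp (@measurable_line_id R) measurable_snd).
    by apply: measurableT_comp => //.
pose H : T * line R -> \bar R := (fun p => gD p.1) \_ A.
have mH : measurable_fun setT H.
  apply/(measurable_restrictT _ _).1 => //.
  by apply: measurable_funTS; apply: measurableT_comp.
have H0 p : 0 <= H p by apply: erestrict_ge0 => q _.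
transitivity (\int[mu]_x \int[lebesgue_line R]_y H (x, y)).
  rewrite integral_mkcond; apply: eq_integral => x _.
  have -> : (fun y => H (x, y)) =
     (cst (gD x)) \_ (below (fD x)).
    apply/funext => l; rewrite /H /patch.
    have -> // : ((x, l) \in A) = (l \in below (fD x)).
      by apply/idP/idP => /set_mem h; apply/mem_set.
  rewrite -integral_mkcond integral_cst ?lebesgue_below//;
    last exact: measurable_below.
  rewrite /gD /fD /patch; case: ifPn => _; last by rewrite mule0.
  by rewrite muleC.
rewrite (tonelli (@sigma_finite_line R))//.
rewrite [RHS]integral_mkcond; apply: eq_integral => l _.
rewrite [RHS]/patch; case: ifPn => [/set_mem|/negP l0].
  rewrite /halfline/= => l0.
  rewrite [RHS]integral_mkcond; apply: eq_integral => x _.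
  rewrite /H /gD /patch /A; case: ifPn => [/set_mem[/= _]|/negP h].
    rewrite /fD /patch; case: ifPn => [/set_mem xD lf|_]; last first.
      by rewrite lte_fin ltNge (ltW l0).
    by rewrite ifT//; apply/mem_set; split.
  case: ifPn => // /set_mem [xD lf]; exfalso; apply: h; apply/mem_set; split => //=.
  by rewrite /fD /patch mem_set.
apply: integral0_eq => x _; rewrite /H /patch /A ifF//.
apply/negP => /set_mem[/= l0' _]; apply: l0; apply/mem_set.
exact: l0'.
Qed.

End layer_cake.

Local Close Scope ereal_scope.

(** * Nonincreasing rearrangements *)

Local Open Scope ereal_scope.

(** Restricting to real l below a avoids the case a = +oo when a is a
    rearrangement or an integral. *)
Lemma lee_above (R : realType) (a b : \bar R) : 0 <= b ->
  (forall l : R, (0 <= l)%R -> l%:E < a -> l%:E <= b) -> a <= b.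
Proof.
case: b => [b| |]// b0 h; last by rewrite leey.
rewrite leNgt; apply/negP; case: a h => [a| |]// h ba.
  have := h ((a + b) / 2)%R; rewrite !lte_fin lee_fin in ba b0 *.
  by move=> /(_ ltac:(lra) ltac:(lra)); rewrite lee_fin; lra.
have := h (b + 1)%R; rewrite lee_fin in b0.
by move=> /(_ ltac:(lra)) /(_ (ltry _)); rewrite lee_fin; lra.
Qed.

Section rearrangement.
Context d (T : measurableType d) (R : realType).
Variables (mu : {measure set T -> \bar R}) (D : set T).
Hypothesis mD : measurable D.
Implicit Types (f g : T -> \bar R) (l s t : R).

Definition distr f l := mu (D `&` [set x | l%:E < `|f x|]).

Lemma measurable_superlevel f l : measurable_fun D f ->
  measurable (D `&` [set x | l%:E < `|f x|]).
Proof.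
by move=> mf; apply: emeasurable_fun_o_infty => //; exact: measurableT_comp.
Qed.

Lemma le_distr f l l' : measurable_fun D f -> (l <= l')%R ->
  distr f l' <= distr f l.
Proof.
move=> mf ll'; apply: le_measure; rewrite ?inE; [exact: measurable_superlevel..|].
by move=> x [Dx /= h]; split => //=; rewrite (le_lt_trans _ h)// lee_fin.
Qed.

(** The distribution function is right-continuous, so the infimum that defines
    the rearrangement is attained. *)
Lemma rearr_leP f l t : measurable_fun D f -> (0 <= l)%R ->
  rearr mu D f t <= l%:E <-> distr f l <= t%:E.
Proof.
move=> mf l0; split => [h|h]; last first.
  apply/lee_addgt0Pr => e e0; apply: ereal_inf_lbound.
  exists (l + e)%R => //; split; first by rewrite ltr_wpDl.
  by apply: le_trans h; apply: le_distr => //; rewrite lerDl ltW.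
pose F (k : nat) := D `&` [set x | (l + k.+1%:R^-1)%:E < `|f x|].
have FE : \bigcup_k F k = D `&` [set x | l%:E < `|f x|].
  apply/seteqP; split => x.
    move=> [k _ [Dx /= hk]]; split => //=.
    by apply: lt_trans hk; rewrite lte_fin ltrDl invr_gt0.
  move=> [Dx /=]; case fx : `|f x| => [r| |] // lr; last by exists 0%N => //; split => //=; rewrite fx ltry.
  rewrite lte_fin -subr_gt0 in lr.
  have [k _ /(_ k (leqnn k)) hk] := near_infty_natSinv_lt (PosNum lr).
  exists k => //; split => //=; rewrite fx lte_fin addrC -ltrBrDr.
  exact: hk.
rewrite /distr -FE.
have mF k : measurable (F k) by exact: measurable_superlevel.
have := @nondecreasing_cvg_mu _ _ _ mu F mF (bigcupT_measurable _ mF).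
have ndF : nondecreasing_seq F.
  move=> i j ij; apply/subsetPset => x [Dx /= hi]; split => //=.
  rewrite (le_lt_trans _ hi)// lee_fin lerD2l lef_pV2 ?posrE//.
  by rewrite ler_nat ltnS.
move=> /(_ ndF) cv; apply: (cvge_to_le cv); apply: nearW => k /=.
have : rearr mu D f t < (l + k.+1%:R^-1)%:E.
  by rewrite (le_lt_trans h)// lte_fin ltrDl invr_gt0.
move=> /ereal_inf_lt[_ [l' [l'0 h'] <-] /ltW]; rewrite lee_fin => l'l.
by apply: le_trans h'; exact: le_distr.
Qed.

Lemma rearr_gtP f l t : measurable_fun D f -> (0 <= l)%R ->
  l%:E < rearr mu D f t <-> t%:E < distr f l.
Proof.
move=> mf l0; have := rearr_leP t mf l0; rewrite !ltNge => h.
by split => /negP h'; apply/negP => h''; apply/h'/h.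
Qed.

Lemma rearr_ge0 f t : 0 <= rearr mu D f t.
Proof.
by apply: le_ereal_inf_tmp => _ [l [l0 _] <-]; rewrite lee_fin ltW.
Qed.

Lemma rearr_nonincreasing f s t : (s <= t)%R ->
  rearr mu D f t <= rearr mu D f s.
Proof.
move=> st; apply: ereal_inf_le_tmp => _ [l [l0 h] <-]; exists l => //.
by split => //; apply: le_trans h _; rewrite lee_fin.
Qed.

Lemma mplus_rearr f : mplus (@halfline R) (rearr mu D f).
Proof.
split => [|t _]; last exact: rearr_ge0.
by apply: measurable_fun_nonincreasing => s t _; exact: rearr_nonincreasing.
Qed.

Lemma superlevel_rearr f l : measurable_fun D f -> (0 <= l)%R ->
  @halfline R `&` [set s | l%:E < rearr mu D f s] = below (distr f l).
Proof.
move=> mf l0; apply/seteqP; split => s [s0 /= h]; split => //.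
  exact/rearr_gtP.
exact/rearr_gtP.
Qed.

End rearrangement.

Section rearrangement_compare.
Context (R : realType).
Context d (T : measurableType d) (mu : {measure set T -> \bar R}) (D : set T).
Context d' (T' : measurableType d') (mu' : {measure set T' -> \bar R})
  (D' : set T').

Lemma le_rearr (f : T -> \bar R) (g : T' -> \bar R) (t : R) :
  (forall l : R, (0 < l)%R -> distr mu D f l <= distr mu' D' g l) ->
  rearr mu D f t <= rearr mu' D' g t.
Proof.
move=> h; apply: ereal_inf_le_tmp => _ [l [l0 hl] <-]; exists l => //.
by split => //; apply: le_trans (h _ l0) hl.
Qed.

End rearrangement_compare.

Lemma eq_rearr (R : realType)
    d (T : measurableType d) (mu : {measure set T -> \bar R}) (D : set T)
    d' (T' : measurableType d') (mu' : {measure set T' -> \bar R}) (D' : set T')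
    (f : T -> \bar R) (g : T' -> \bar R) (t : R) :
  (forall l : R, (0 < l)%R -> distr mu D f l = distr mu' D' g l) ->
  rearr mu D f t = rearr mu' D' g t.
Proof.
by move=> h; apply/eqP; rewrite eq_le; apply/andP; split; apply: le_rearr => l l0;
  rewrite h.
Qed.

Lemma distr_rearr (R : realType) d (T : measurableType d)
    (mu : {measure set T -> \bar R}) (D : set T) (mD : measurable D)
    (f : T -> \bar R) (l : R) : measurable_fun D f -> (0 <= l)%R ->
  distr (lebesgue_line R) (@halfline R) (rearr mu D f) l = distr mu D f l.
Proof.
move=> mf l0; rewrite {1}/distr.
rewrite [X in lebesgue_line R X](_ : _ = below (distr mu D f l)).
  by rewrite lebesgue_below//; exact: measure_ge0.
rewrite -superlevel_rearr//; apply/seteqP.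
by split => s [s0 /=]; rewrite gee0_abs ?rearr_ge0.
Qed.

(** Up to a null set every superlevel set of f lies in the one of g. *)
Lemma le_rearr_ae (R : realType) d (T : measurableType d)
    (mu : {measure set T -> \bar R}) (D : set T) (f g : T -> \bar R) (t : R) :
  measurable D -> measurable_fun D f -> measurable_fun D g ->
  {ae mu, forall x, D x -> `|f x| <= `|g x|} ->
  rearr mu D f t <= rearr mu D g t.
Proof.
move=> mD mf mg [N [mN N0 hN]]; apply: le_rearr => l l0.
have mfl := measurable_superlevel mD l mf.
have mgl := measurable_superlevel mD l mg.
rewrite /distr -[leRHS](measureU0 mgl mN N0).
apply: le_measure; rewrite ?inE; [exact: mfl|exact: measurableU|].
move=> x [Dx /= lf]; have [fg|fg] := leP `|f x| `|g x|.
  by left; split => //=; exact: lt_le_trans fg.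
by right; apply: hN => /= h; have := h Dx; rewrite leNgt fg.
Qed.

Lemma nondecreasing_le_lim (R : realType) (u : nat -> \bar R) (l : \bar R) j :
  nondecreasing_seq u -> u @ \oo --> l -> u j <= l.
Proof.
move=> nd cv; rewrite -(cvg_lim _ cv)// (cvg_lim _ (ereal_nondecreasing_cvgn nd))//.
by apply: ereal_sup_ubound; exists j.
Qed.

Section rearr_more.
Context (R : realType) d (T : measurableType d).
Variables (mu : {measure set T -> \bar R}) (D : set T).
Hypothesis mD : measurable D.
Implicit Types (f g : T -> \bar R) (l s t c : R).

Lemma rearr_scale f c t : measurable_fun D f -> (0 < c)%R ->
  rearr mu D (fun x => c%:E * f x) t = c%:E * rearr mu D f t.
Proof.
move=> mf c0; have mcf : measurable_fun D (fun x => c%:E * f x).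
  exact: measurable_funeM.
have dE l : (0 <= l)%R ->
    distr mu D (fun x => c%:E * f x) l = distr mu D f (c^-1 * l).
  move=> l0; rewrite /distr; congr (mu (_ `&` _)); apply/eq_set => x.
  by rewrite abseM gee0_abs ?lee_fin ?(ltW c0)// EFinM lte_pdivrMl.
have c0' : (0 <= c^-1)%R by rewrite invr_ge0 ltW.
apply/eqP; rewrite eq_le; apply/andP; split.
  apply: lee_above; first by rewrite mule_ge0 ?rearr_ge0// lee_fin ltW.
  move=> l l0 /(rearr_gtP mu mD _ mcf l0); rewrite dE// => h.
  have cl0 : (0 <= c^-1 * l)%R by rewrite mulr_ge0.
  by rewrite -lee_pdivrMl// -EFinM ltW//; apply/(rearr_gtP mu mD _ mf cl0).
apply: lee_above; first exact: rearr_ge0.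
  move=> l l0; rewrite -lte_pdivrMl// -EFinM => h.
  have cl0 : (0 <= c^-1 * l)%R by rewrite mulr_ge0.
  apply/ltW/(rearr_gtP mu mD _ mcf l0); rewrite dE//.
  exact/(rearr_gtP mu mD _ mf cl0).
Qed.

Lemma rearr_eq0 f t : measurable_fun D f ->
  distr mu D f 0 <= t%:E -> rearr mu D f t = 0.
Proof.
move=> mf h; apply/eqP; rewrite eq_le rearr_ge0 andbT.
by apply/(rearr_leP mu mD t mf).
Qed.

(** If l < f*(t), then the set where f exceeds l has measure more than t.  It is,
    up to a null set, the increasing union of the sets where f_j exceeds l, so one
    of these has measure more than t already, and f_j*(t) > l. *)
Lemma cvg_rearr (f_ : nat -> T -> \bar R) f t :
  (forall j, mplus D (f_ j)) -> mplus D f ->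
  {ae mu, forall x, D x -> nondecreasing_seq (fun j => f_ j x) /\
                             f_ j x @[j --> \oo] --> f x} ->
  nondecreasing_seq (fun j => rearr mu D (f_ j) t) /\
  rearr mu D (f_ j) t @[j --> \oo] --> rearr mu D f t.
Proof.
move=> pf_ pf ae_cv; have [N [mN N0 hN]] := ae_cv.
have good x : D x -> ~ N x -> nondecreasing_seq (fun j => f_ j x) /\
    f_ j x @[j --> \oo] --> f x.
  by move=> Dx Nx; apply: contrapT => h; apply: Nx; apply: hN => /(_ Dx).
have nd : nondecreasing_seq (fun j => rearr mu D (f_ j) t).
  move=> i j ij; apply: le_rearr_ae; [exact: mD|exact: (pf_ i).1|exact: (pf_ j).1|].
  apply: filterS ae_cv => x h Dx.
  by rewrite !gee0_abs ?(pf_ _).2//; exact: (h Dx).1.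
split => //.
have cv := ereal_nondecreasing_cvgn nd.
suff -> : rearr mu D f t = ereal_sup (range (fun j => rearr mu D (f_ j) t)) by [].
apply/eqP; rewrite eq_le; apply/andP; split; last first.
  apply: ge_ereal_sup => _ [j _ <-].
  apply: le_rearr_ae; [exact: mD|exact: (pf_ j).1|exact: pf.1|].
  apply: filterS ae_cv => x h Dx; rewrite !gee0_abs ?(pf_ _).2 ?pf.2//.
  by have [ndx cvx] := h Dx; exact: (nondecreasing_le_lim j ndx cvx).
apply: lee_above.
  by apply: ereal_sup_ge; exists (rearr mu D (f_ 0%N) t); [exists 0%N|exact: rearr_ge0].
move=> l l0 /(rearr_gtP mu mD _ pf.1 l0) tl.
pose G j := (D `&` [set x | l%:E < `|f_ j x|]) `\` N.
have ms h : mplus D h -> measurable (D `&` [set x | l%:E < `|h x|]).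
  by move=> ph; exact: measurable_superlevel ph.1.
have mG j : measurable (G j) by apply: measurableD => //; exact: ms.
have ndG : nondecreasing_seq G.
  move=> i j ij; apply/subsetPset => x [[Dx /= lx] Nx]; split => //; split => //=.
  apply: lt_le_trans lx _; rewrite !gee0_abs ?(pf_ _).2//.
  exact: (good x Dx Nx).1.
have GE : \bigcup_j G j = (D `&` [set x | l%:E < `|f x|]) `\` N.
  apply/seteqP; split => x.
    move=> [j _ [[Dx /= lx] Nx]]; split => //; split => //=.
    apply: lt_le_trans lx _; rewrite !gee0_abs ?(pf_ _).2 ?pf.2//.
    by have [ndx cvx] := good x Dx Nx; exact: (nondecreasing_le_lim j ndx cvx).
  move=> [[Dx /=]]; rewrite gee0_abs ?pf.2// => lx Nx.
  have [ndx cvx] := good x Dx Nx.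
  have [j lj] : exists j, l%:E < f_ j x.
    apply: contrapT => /forallNP h; move: lx; apply/negP; rewrite -leNgt.
    by apply: (cvge_to_le cvx); apply: nearW => j; rewrite leNgt; apply/negP; exact: h.
  by exists j => //; split => //; split => //=; rewrite gee0_abs ?(pf_ _).2.
have := @nondecreasing_cvg_mu _ _ _ mu G mG (bigcupT_measurable _ mG) ndG.
rewrite GE => cvG.
have muE : mu ((D `&` [set x | l%:E < `|f x|]) `\` N) = distr mu D f l.
  have mA : measurable (D `&` [set x | l%:E < `|f x|]) by exact: ms.
  rewrite -(measureU0 (B := (D `&` [set x | l%:E < `|f x|]) `&` N)).
  - congr (mu _); apply/seteqP; split => x; first by move=> [[]|[]].
    by move=> Ax; have [Nx|Nx] := pselect (N x); [right|left].
  - exact: measurableD.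
  - exact: measurableI.
  - apply: (subset_measure0 _ mN _ N0); [exact: measurableI|exact: subIsetr].
rewrite muE in cvG.
have [j tj] : exists j, t%:E < mu (G j).
  apply: contrapT => /forallNP h; move: tl; apply/negP; rewrite -leNgt.
  by apply: (cvge_to_le cvG); apply: nearW => j /=; rewrite leNgt; apply/negP; exact: h.
apply: ereal_sup_ge; exists (rearr mu D (f_ j) t); first by exists j.
apply/ltW/(rearr_gtP mu mD _ (pf_ j).1 l0); apply: lt_le_trans tj _.
by apply: le_measure; rewrite ?inE; [exact: mG|exact: ms|exact: subDsetl].
Qed.

End rearr_more.

Local Close Scope ereal_scope.

(** * Averages of rearrangements *)

Local Open Scope ereal_scope.

Section layers.
Context (R : realType) d (T : measurableType d).
Variables (mu : {measure set T -> \bar R}) (D : set T).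
Hypothesis mD : measurable D.
Implicit Types (f g : T -> \bar R) (r : R).

Lemma measurable_layers f g : mplus D f -> mplus D g ->
  measurable_fun (@halfline R)
    (fun l : line R => \int[mu]_(x in D `&` [set x | (l : R)%:E < f x]) g x).
Proof.
move=> [mf f0] [mg g0]; apply: measurable_fun_nonincreasing => s t s0 st.
have mA (u : R) : measurable (D `&` [set x | u%:E < f x]).
  exact: emeasurable_fun_o_infty.
apply: ge0_subset_integral => //.
- by apply: measurable_funS mg => // x [].
- by move=> x [Dx _]; exact: g0.
- move=> x [Dx /= h]; split => //=.
  by rewrite (le_lt_trans _ h)// lee_fin.
Qed.

Lemma integral_layers_ge0 f g r : mplus D g ->
  0 <= \int[mu]_(x in D `&` [set x | r%:E < f x]) g x.
Proof. by move=> [_ g0]; apply: integral_ge0 => x [Dx _]; exact: g0. Qed.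

End layers.

Section compare.
Context (R : realType).
Context d (T : measurableType d) (mu : {measure set T -> \bar R}) (D : set T).
Hypotheses (smu : sigma_finite setT mu) (mD : measurable D).
Context d' (T' : measurableType d') (mu' : {measure set T' -> \bar R})
  (D' : set T').
Hypotheses (smu' : sigma_finite setT mu') (mD' : measurable D').

(** Integrals over different measure spaces compare as soon as their layers do.
    The first factor is the one that is cut into layers; for a kernel whose
    superlevel sets are balls, cubes or intervals the layers are integrals of the
    second factor over such sets. *)
Lemma le_integral_layers (f g : T -> \bar R) (F G : T' -> \bar R) :
  mplus D f -> mplus D g -> mplus D' F -> mplus D' G ->
  (forall l : R, (0 < l)%R ->
    \int[mu]_(x in D `&` [set x | l%:E < f x]) g x <=
    \int[mu']_(x in D' `&` [set x | l%:E < F x]) G x) ->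
  \int[mu]_(x in D) (f x * g x) <= \int[mu']_(x in D') (F x * G x).
Proof.
move=> pf pg pF pG h; rewrite (layer_cake smu mD pf pg) (layer_cake smu' mD' pF pG).
apply: ge0_le_integral.
- exact: measurable_halfline.
- by move=> l _; exact: integral_layers_ge0.
- exact: measurable_layers.
- exact: measurable_layers.
- exact: h.
Qed.

Lemma le_integral_distr (f : T -> \bar R) (F : T' -> \bar R) :
  mplus D f -> mplus D' F ->
  (forall l : R, (0 < l)%R -> distr mu D f l <= distr mu' D' F l) ->
  \int[mu]_(x in D) f x <= \int[mu']_(x in D') F x.
Proof.
move=> pf pF h.
have p1 d0 (U : measurableType d0) (E : set U) : mplus E (cst 1 : U -> \bar R).
  by split => // *; rewrite lee01.
have := le_integral_layers pf (p1 _ _ D) pF (p1 _ _ D').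
under eq_integral do rewrite mule1.
under [leRHS]eq_integral do rewrite mule1.
apply => l l0; have := h _ l0; rewrite /distr.
have [mf f0] := pf; have [mF F0] := pF.
rewrite !integral_cst ?mul1e//; try exact: emeasurable_fun_o_infty.
have -> : D `&` [set x | l%:E < `|f x|] = D `&` [set x | l%:E < f x].
  by apply/seteqP; split => x [Dx /=]; rewrite gee0_abs ?f0.
have -> // : D' `&` [set x | l%:E < `|F x|] = D' `&` [set x | l%:E < F x].
by apply/seteqP; split => x [Dx /=]; rewrite gee0_abs ?F0.
Qed.

End compare.

Section excess.
Context (R : realType).

(** The truncation (f - lam)+, with value +oo where f is infinite. *)
Definition excess (T : Type) (f : T -> \bar R) (lam : R) (x : T) : \bar R :=
  maxe (f x - lam%:E) 0.

Lemma excess_gt (T : Type) (f : T -> \bar R) (lam l : R) (x : T) : (0 <= l)%R ->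
  (l%:E < excess f lam x) = ((lam + l)%:E < f x).
Proof.
move=> l0; rewrite /excess lt_max [X in _ || X]ltNge lee_fin l0 orbF.
by rewrite lteBrDr// -EFinD addrC.
Qed.

Lemma excess_ge0 (T : Type) (f : T -> \bar R) (lam : R) (x : T) :
  0 <= excess f lam x.
Proof. by rewrite le_max lexx orbT. Qed.

Lemma le_addr_excess (T : Type) (f : T -> \bar R) (lam : R) (x : T) :
  f x <= lam%:E + excess f lam x.
Proof. by rewrite -leeBlDl// le_max lexx. Qed.

Context d (T : measurableType d).
Variables (mu : {measure set T -> \bar R}) (D : set T).
Hypotheses (smu : sigma_finite setT mu) (mD : measurable D).
Implicit Types (f g : T -> \bar R) (lam r : R).

Lemma mplus_excess f lam : mplus D f -> mplus D (excess f lam).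
Proof.
move=> [mf _]; split => [|x _]; last exact: excess_ge0.
by apply: measurable_maxe => //; exact: emeasurable_funB.
Qed.

Lemma distr_excess f lam l : mplus D f -> (0 <= lam)%R -> (0 <= l)%R ->
  distr mu D (excess f lam) l = distr mu D f (lam + l).
Proof.
move=> [mf f0] lam0 l0; rewrite /distr; congr (mu _).
apply/seteqP; split => x [Dx /=].
  by rewrite gee0_abs ?excess_ge0// excess_gt// gee0_abs ?f0.
by rewrite [in X in X -> _]gee0_abs ?f0// gee0_abs ?excess_ge0// excess_gt.
Qed.

(** A function and its rearrangement have the same distribution function, hence so
    do their excesses over a level. *)
Lemma integral_excess_rearr f lam : mplus D f -> (0 <= lam)%R ->
  \int[lebesgue_line R]_(s in @halfline R) excess (rearr mu D f) lam s =
  \int[mu]_(x in D) excess f lam x.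
Proof.
move=> pf lam0.
have e l : (0 < l)%R ->
  distr (lebesgue_line R) (@halfline R) (excess (rearr mu D f) lam) l =
  distr mu D (excess f lam) l.
  move=> /ltW l0; rewrite [RHS]distr_excess//.
  rewrite -(distr_rearr mu mD pf.1 (addr_ge0 lam0 l0)) /distr.
  congr (lebesgue_line R _); apply/seteqP; split => x [Dx /=].
    rewrite [in X in X -> _]gee0_abs ?excess_ge0// excess_gt//.
    by rewrite gee0_abs ?rearr_ge0.
  rewrite [in X in X -> _]gee0_abs ?rearr_ge0//.
  by rewrite gee0_abs ?excess_ge0// excess_gt.
have pr : mplus (@halfline R) (excess (rearr mu D f) lam : line R -> \bar R).
  have [mr _] := mplus_rearr mu D f.
  split => [|x _]; last exact: excess_ge0.
  apply: measurable_maxe; last exact: measurable_cst.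
  by apply: emeasurable_funB => //; exact: measurable_cst.
have pe := mplus_excess lam pf.
apply/eqP; rewrite eq_le; apply/andP; split.
  apply: (le_integral_distr (@sigma_finite_line R) (@measurable_halfline R) smu mD pr pe).
  by move=> l l0; rewrite e.
apply: (le_integral_distr smu mD (@sigma_finite_line R) (@measurable_halfline R) pe pr).
by move=> l l0; rewrite e.
Qed.

Lemma integral_le_excess (E : set T) f lam r : measurable E -> E `<=` D ->
  mplus D f -> (0 <= lam)%R -> mu E <= r%:E ->
  \int[mu]_(x in E) f x <= (lam * r)%:E + \int[mu]_(x in D) excess f lam x.
Proof.
move=> mE ED pf lam0 Er.
have [me e0] := mplus_excess lam pf.
have meE : measurable_fun E (excess f lam) by exact: measurable_funS me.
have [mf f0] := pf.
apply: (@le_trans _ _ (\int[mu]_(x in E) (lam%:E + excess f lam x))).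
  apply: ge0_le_integral.
  - exact: mE.
  - by move=> x /ED; exact: f0.
  - exact: measurable_funS mf.
  - by apply: emeasurable_funD => //; exact: measurable_cst.
  - by move=> x _; exact: le_addr_excess.
rewrite ge0_integralD//; last by move=> x _; exact: excess_ge0.
apply: leeD; last exact: ge0_subset_integral.
by rewrite integral_cst// EFinM lee_wpmul2l.
Qed.

End excess.

Section integral_rearr.
Context (R : realType).
Implicit Types (u : line R -> \bar R) (r : R).

Lemma measurable_belowS u r : measurable_fun (@halfline R) u ->
  measurable_fun (below r%:E) u.
Proof.
apply: measurable_funS; first exact: measurable_halfline.
by move=> s [].
Qed.

(** For a nonincreasing u the bound of [integral_le_excess] on ]0, r[ is attained
    at the level lam = u r, since u is above that level before r and below it
    after r. *)
Lemma integral_below_excess u r (lam : R) : mplus (@halfline R) u ->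
  (forall s t : R, (0 < s)%R -> (s <= t)%R -> u t <= u s) -> (0 < r)%R ->
  u r = lam%:E ->
  \int[lebesgue_line R]_(s in below r%:E) u s =
  (lam * r)%:E + \int[lebesgue_line R]_(s in @halfline R) excess u lam s.
Proof.
move=> [mu u0] u_ni r0 ur.
have lam0 : (0 <= lam)%R by rewrite -lee_fin -ur; exact: u0.
have mb : measurable (below r%:E) by exact: measurable_below.
have -> : \int[lebesgue_line R]_(s in @halfline R) excess u lam s =
          \int[lebesgue_line R]_(s in below r%:E) excess u lam s.
  rewrite integral_mkcond [RHS]integral_mkcond; apply: eq_integral => s _.
  rewrite /patch; case: ifPn => [/set_mem s0|s0]; case: ifPn => [/set_mem sr|sr] //.
    rewrite /excess max_r// sube_le0 -ur; apply: u_ni => //.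
    move: sr => /negP; rewrite inE => sr; rewrite leNgt; apply/negP => sr'.
    by apply: sr; split => //; rewrite lte_fin.
  by move: s0 => /negP; rewrite inE; case; case: sr.
have me : measurable_fun (below r%:E) (excess u lam).
  apply: measurable_maxe; last exact: measurable_cst.
  by apply: emeasurable_funB; [exact: measurable_belowS|exact: measurable_cst].
transitivity (\int[lebesgue_line R]_(s in below r%:E) (lam%:E + excess u lam s)).
  apply: eq_integral => s /set_mem [s0]; rewrite lte_fin => sr.
  have : lam%:E <= u s by rewrite -ur u_ni// ltW.
  rewrite /excess -sube_ge0// => h; rewrite max_l//.
  by rewrite addeC subeK.
rewrite ge0_integralD.
- rewrite integral_cst; last exact: mb.
  by rewrite lebesgue_below ?lee_fin ?(ltW r0)// EFinM.
- exact: mb.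
- by move=> x _; rewrite lee_fin.
- exact: measurable_cst.
- by move=> x _; exact: excess_ge0.
- exact: me.
Qed.

Lemma below_ge u r : mplus (@halfline R) u ->
  (forall s t : R, (0 < s)%R -> (s <= t)%R -> u t <= u s) -> (0 < r)%R ->
  u r * r%:E <= \int[lebesgue_line R]_(s in below r%:E) u s.
Proof.
move=> [mu u0] u_ni r0.
have mb : measurable (below r%:E) by exact: measurable_below.
rewrite -[X in _ * X]lebesgue_below; last by rewrite lee_fin ltW.
rewrite -integral_cst; last exact: mb.
apply: ge0_le_integral.
- exact: mb.
- by move=> s _; exact: u0.
- exact: measurable_cst.
- exact: measurable_belowS.
- by move=> s [s0]; rewrite lte_fin => sr; apply: u_ni => //; exact: ltW.
Qed.

End integral_rearr.

Section hardy_littlewood.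
Context (R : realType) d (T : measurableType d).
Variables (mu : {measure set T -> \bar R}) (D : set T).
Hypotheses (smu : sigma_finite setT mu) (mD : measurable D).
Implicit Types (f g : T -> \bar R) (r : R).

Lemma integral_below_rearr f r (lam : R) : mplus D f -> (0 < r)%R ->
  rearr mu D f r = lam%:E ->
  \int[lebesgue_line R]_(s in below r%:E) rearr mu D f s =
  (lam * r)%:E + \int[mu]_(x in D) excess f lam x.
Proof.
move=> pf r0 fr; rewrite -integral_excess_rearr//; last first.
  by rewrite -lee_fin -fr rearr_ge0.
apply: integral_below_excess => //; first exact: mplus_rearr.
by move=> s t _; exact: rearr_nonincreasing.
Qed.

Lemma below_rearr_infty f r : (0 < r)%R -> rearr mu D f r = +oo ->
  \int[lebesgue_line R]_(s in below r%:E) rearr mu D f s = +oo.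
Proof.
move=> r0 fr; apply/eqP; rewrite -leye_eq.
have <- : rearr mu D f r * r%:E = +oo by rewrite fr gt0_mulye ?lte_fin.
apply: below_ge => //; first exact: mplus_rearr.
by move=> s t _; exact: rearr_nonincreasing.
Qed.

(** Both sides are compared with lam * r + int (f - lam)+ at lam = f*(r): it bounds
    the left one from above and equals the right one. *)
Lemma integral_le_below_rearr (E : set T) f r : measurable E -> E `<=` D ->
  mplus D f -> (0 < r)%R -> mu E <= r%:E ->
  \int[mu]_(x in E) f x <= \int[lebesgue_line R]_(s in below r%:E) rearr mu D f s.
Proof.
move=> mE ED pf r0 Er; case fr : (rearr mu D f r) => [lam| |].
- rewrite (integral_below_rearr pf r0 fr); apply: integral_le_excess => //.
  by rewrite -lee_fin -fr rearr_ge0.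
- by rewrite below_rearr_infty// leey.
- by have := rearr_ge0 mu D f r; rewrite fr.
Qed.

(** The average of the rearrangement is subadditive although the rearrangement
    is not: it minimizes lam * r + int (f - lam)+ over all levels lam, and the
    levels of f and g add up to a level of f + g. *)
Lemma below_rearrD f g r : mplus D f -> mplus D g -> (0 < r)%R ->
  \int[lebesgue_line R]_(s in below r%:E) rearr mu D (fun x => f x + g x) s <=
  \int[lebesgue_line R]_(s in below r%:E) rearr mu D f s +
  \int[lebesgue_line R]_(s in below r%:E) rearr mu D g s.
Proof.
move=> pf pg r0; have [mf f0] := pf; have [mg g0] := pg.
have ge0 h : 0 <= \int[lebesgue_line R]_(s in below r%:E) rearr mu D h s.
  by apply: integral_ge0 => s _; exact: rearr_ge0.
case fr : (rearr mu D f r) => [lam| |]; last 2 first.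
- by rewrite (below_rearr_infty r0 fr) addye ?leey// gt_eqF// (lt_le_trans _ (ge0 g)).
- by have := rearr_ge0 mu D f r; rewrite fr.
case gr : (rearr mu D g r) => [eta| |]; last 2 first.
- rewrite (below_rearr_infty r0 gr) addey ?leey//.
  by rewrite gt_eqF// (lt_le_trans _ (ge0 f)).
- by have := rearr_ge0 mu D g r; rewrite gr.
have lam0 : (0 <= lam)%R by rewrite -lee_fin -fr rearr_ge0.
have eta0 : (0 <= eta)%R by rewrite -lee_fin -gr rearr_ge0.
have pfg : mplus D (fun x => f x + g x).
  by split => [|x Dx]; [exact: emeasurable_funD|rewrite adde_ge0 ?f0 ?g0].
rewrite (integral_below_rearr pf r0 fr) (integral_below_rearr pg r0 gr).
have h : \int[lebesgue_line R]_(s in below r%:E) rearr mu D (fun x => f x + g x) s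
    <= ((lam + eta) * r)%:E + \int[mu]_(x in D) excess (fun x => f x + g x) (lam + eta) x.
  rewrite -integral_excess_rearr ?addr_ge0//.
  apply: integral_le_excess.
  - exact: measurable_halfline.
  - exact: measurable_below.
  - by move=> s [].
  - exact: mplus_rearr.
  - exact: addr_ge0.
  - by rewrite lebesgue_below// lee_fin ltW.
apply: (le_trans h); rewrite [leRHS]addeACA -EFinD -mulrDl; apply: leeD2l.
have [mef ef0] := mplus_excess lam pf; have [meg eg0] := mplus_excess eta pg.
rewrite -ge0_integralD//.
have [mefg efg0] := mplus_excess (lam + eta) pfg.
apply: ge0_le_integral => //; first exact: emeasurable_funD.
move=> x Dx; rewrite {1}/excess ge_max adde_ge0 ?ef0 ?eg0// andbT.
rewrite leeBlDl// EFinD addeACA leeD//; exact: le_addr_excess.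
Qed.

End hardy_littlewood.

Local Close Scope ereal_scope.

(** * Powers and the Gamma function *)

Lemma ge0_integral_bigcup_le d (T : measurableType d) (R : realType)
    (mu : {measure set T -> \bar R}) (F : nat -> set T) (f : T -> \bar R)
    (c : \bar R) :
  nondecreasing_seq F -> (forall k, measurable (F k)) ->
  measurable_fun setT f -> (forall x, 0 <= f x)%E ->
  (forall k, \int[mu]_(x in F k) f x <= c)%E ->
  (\int[mu]_(x in \bigcup_k F k) f x <= c)%E.
Proof.
move=> ndF mF mf f0 h.
have cv := @ge0_nondecreasing_set_cvg_integral _ _ R F f mu ndF mF
  (fun i => measurable_funTS mf) (fun i x _ => f0 x).
by apply: (cvge_to_le cv); exact: nearW.
Qed.

Section power_integral.
Context (R : realType).
Implicit Types (a b s t l : R).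
Notation leb := (@lebesgue_measure R).

Lemma measurable_powRE b : measurable_fun setT (fun x : R => (x `^ b)%:E).
Proof. by apply/measurable_EFinP; exact: measurable_powR. Qed.

Lemma powRE_ge0 b (x : R) : (0 <= (x `^ b)%:E)%E.
Proof. by rewrite lee_fin powR_ge0. Qed.

Lemma itv_pos s t x : 0 < s -> x \in `[s, t] -> 0 < x.
Proof. by move=> s0; rewrite in_itv/= => /andP[sx _]; exact: lt_le_trans sx. Qed.

Lemma continuous_powR b (x : R) : 0 < x -> {for x, continuous (fun y : R => y `^ b)}.
Proof.
move=> x0; apply/differentiable_continuous/derivable1_diffP.
by apply: derivable_powR; rewrite in_itv/= andbT.
Qed.

Lemma integral_powR_segment b s t : b != 0 -> 0 < s -> s < t ->
  (\int[leb]_(x in `[s, t]) (x `^ (b - 1))%:E = ((t `^ b - s `^ b) / b)%:E)%E.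
Proof.
move=> b0 s0 st.
rewrite (@continuous_FTC2 _ _ (fun x => b^-1 * x `^ b)) //.
- by rewrite -EFinB -mulrBr mulrC.
- apply: continuous_in_subspaceT => x /set_mem /= xst.
  exact: (continuous_powR (itv_pos s0 xst)).
- split.
  + move=> x; rewrite in_itv/= => /andP[sx _]; apply: derivableM => //.
    by apply: derivable_powR; rewrite in_itv/= andbT (lt_trans s0).
  + apply: cvg_at_right_filter; apply: cvgM; first exact: cvg_cst.
    exact: continuous_powR.
  + apply: cvg_at_left_filter; apply: cvgM; first exact: cvg_cst.
    by apply: continuous_powR; exact: lt_trans st.
- move=> x; rewrite in_itv/= => /andP[sx _].
  have x0 : x \in `]0, +oo[ by rewrite in_itv/= andbT (lt_trans s0).
  rewrite derive1Ml; last exact: derivable_powR.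
  by rewrite powR_derive1// mulrA mulVf// mul1r.
Qed.

(** The primitive x^b / b is continuous at 0 but the integrand need not be, so the
    fundamental theorem is applied on [s, t] and s tends to 0. *)
Lemma integral_powR_near0 b t : 0 < b -> 0 < t ->
  (\int[leb]_(x in `]0%R, t]) (x `^ (b - 1))%:E <= (t `^ b / b)%:E)%E.
Proof.
move=> b0 t0; pose F (k : nat) := `[t * (k.+2%:R)^-1, t]%classic.
have FE : `]0, t]%classic = \bigcup_k F k.
  apply/seteqP; split => x /=; rewrite in_itv/=; last first.
    move=> [k _]; rewrite /F/= in_itv/= => /andP[h ->]; rewrite andbT.
    by apply: lt_le_trans h; rewrite mulr_gt0.
  move=> /andP[x0 xt].
  have xt0 : 0 < x / t by rewrite divr_gt0.
  have [k _ /(_ k (leqnn k)) /= hk] := near_infty_natSinv_lt (PosNum xt0).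
  exists k => //; rewrite /F/= in_itv/= xt andbT.
  rewrite mulrC -ler_pdivlMr//; apply: le_trans (ltW hk).
  by rewrite lef_pV2 ?posrE// ler_nat.
rewrite FE.
have ndF : nondecreasing_seq F.
  move=> i j ij; apply/subsetPset => x; rewrite /F/= !in_itv/= => /andP[h ->].
  rewrite andbT; apply: le_trans h; rewrite ler_pM2l// lef_pV2 ?posrE//.
  by rewrite ler_nat !ltnS.
apply: ge0_integral_bigcup_le => //.
- by move=> k; exact: measurable_itv.
- exact: measurable_powRE.
- exact: powRE_ge0.
move=> k; have lt1 : (k.+2%:R)^-1 < 1 :> R by rewrite invf_lt1// ltr1n.
have s0 : 0 < t * (k.+2%:R)^-1 by rewrite mulr_gt0.
rewrite integral_powR_segment ?gt_eqF//; last by rewrite gtr_pMr.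
by rewrite lee_fin ler_pM2r ?invr_gt0// gerBl powR_ge0.
Qed.

Lemma integral_powR_near_infty b s : b < 0 -> 0 < s ->
  (\int[leb]_(x in `[s, +oo[) (x `^ (b - 1))%:E <= (s `^ b / - b)%:E)%E.
Proof.
move=> b0 s0; pose F (k : nat) := `[s, s + k.+1%:R]%classic.
have -> : `[s, +oo[%classic = \bigcup_k F k.
  apply/seteqP; split => x /=; rewrite in_itv/=; last first.
    by move=> [k _]; rewrite /F/= in_itv/= => /andP[->].
  rewrite andbT => sx; exists (Num.truncn (x - s)) => //.
  rewrite /F/= in_itv/= sx/= -lerBlDl ltW//.
  by rewrite -truncn_le_nat.
apply: ge0_integral_bigcup_le => //.
- move=> i j ij; apply/subsetPset => x; rewrite /F/= !in_itv/= => /andP[-> /= h].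
  by apply: le_trans h _; rewrite lerD2l ler_nat ltnS.
- by move=> k; exact: measurable_itv.
- exact: measurable_powRE.
- exact: powRE_ge0.
move=> k; rewrite integral_powR_segment ?lt_eqF//; last by rewrite ltrDl.
rewrite lee_fin invrN mulrN -mulNr ler_nM2r ?invr_lt0//.
by rewrite lerDr powR_ge0.
Qed.

End power_integral.

Section gamma_function.
Context (R : realType).
Implicit Types (a : R).
Notation leb := (@lebesgue_measure R).

Lemma powR_le_expR (p x : R) : 0 <= p -> 1 <= x ->
  x `^ p <= ((Num.truncn p).+1)`!%:R * expR x.
Proof.
move=> p0 x1; set N := (Num.truncn p).+1.
have pN : p <= N%:R by apply: ltW; rewrite -truncn_lt_nat.
have x0 : 0 <= x by rewrite (le_trans ler01).
apply: (le_trans (ler_powR x1 pN)); rewrite powR_mulrn//.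
rewrite mulrC -ler_pdivrMr ?ltr0n ?fact_gt0//.
by apply: le_trans (expR_ge1Dxn (Num.truncn p) x0); rewrite -/N lerDr.
Qed.

Definition gamma_density a (t : R) : \bar R := (t `^ (a - 1) * expR (- t))%:E.

Lemma measurable_gamma_density a : measurable_fun setT (gamma_density a).
Proof.
apply/measurable_EFinP; apply: measurable_funM; first exact: measurable_powR.
by apply: measurableT_comp => //; exact: measurable_funN.
Qed.

Lemma gamma_density_ge0 a t : (0 <= gamma_density a t)%E.
Proof. by rewrite lee_fin mulr_ge0 ?powR_ge0 ?expR_ge0. Qed.

Lemma gamma_integral_lty a : 0 < a ->
  (\int[leb]_(t in `]0%R, +oo[) gamma_density a t < +oo)%E.
Proof.
move=> a0.
have -> : `]0%R, +oo[%classic = `]0%R, 1%R] `|` `]1%R, +oo[ :> set R.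
  by rewrite -itv_bndbnd_setU// bnd_simp.
have md D : measurable_fun D (gamma_density a).
  exact: measurable_funTS (measurable_gamma_density a).
rewrite ge0_integral_setU//=; last 3 first.
- exact: md.
- by move=> x _; exact: gamma_density_ge0.
- rewrite disj_set2E; apply/eqP/seteqP; split => // x [] /=.
  by rewrite !in_itv/= andbT => /andP[_ x1]; rewrite ltNge x1.
apply: lte_add_pinfty.
  apply: (@le_lt_trans _ _ (\int[leb]_(t in `]0%R, 1%R]) (t `^ (a - 1))%:E)%E).
    apply: ge0_le_integral => //.
    - by move=> x _; exact: gamma_density_ge0.
    - exact: md.
    - by apply: measurable_funTS; exact: measurable_powRE.
    - move=> x /=; rewrite in_itv/= => /andP[x0 _].
      by rewrite lee_fin ler_piMr ?powR_ge0// expR_le1 oppr_le0 ltW.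
  by apply: le_lt_trans (integral_powR_near0 a0 ltr01) _; rewrite ltry.
set C : R := ((Num.truncn (a + 1)).+1)`!%:R.
apply: (@le_lt_trans _ _
  (\int[leb]_(t in `[1%R, +oo[) (C%:E * (t `^ (-1 - 1))%:E))%E).
  (* t^(a + 1) is at most C e^t for t >= 1 *)
  apply: (@le_trans _ _
    (\int[leb]_(t in `]1%R, +oo[) (C%:E * (t `^ (-1 - 1))%:E))%E).
    apply: ge0_le_integral => //.
    - by move=> x _; exact: gamma_density_ge0.
    - exact: md.
    - by apply: measurable_funTS; apply: measurable_funeM; exact: measurable_powRE.
    - move=> x /=; rewrite in_itv/= andbT => x1.
      have x0 : 0 < x by rewrite (lt_trans ltr01).
      rewrite -EFinM lee_fin expRN ler_pdivrMr ?expR_gt0//.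
      have := powR_le_expR (ltW (addr_gt0 a0 ltr01)) (ltW x1).
      rewrite -/C => h.
      have -> : a - 1 = (a + 1) + (-1 - 1) by ring.
      rewrite powRD; last by rewrite (gt_eqF x0) implybT.
      by rewrite mulrAC ler_wpM2r// powR_ge0.
  apply: ge0_subset_integral => //.
  - by apply: measurable_funTS; apply: measurable_funeM; exact: measurable_powRE.
  - by move=> x _; rewrite mule_ge0 ?powRE_ge0// lee_fin.
  - by move=> x /=; rewrite !in_itv/= !andbT; exact: ltW.
rewrite ge0_integralZl_EFin//.
- apply: lte_mul_pinfty => //; first by rewrite lee_fin.
  apply: le_lt_trans (integral_powR_near_infty _ ltr01) _; last by rewrite ltry.
  by rewrite oppr_lt0.
- by move=> x _; exact: powRE_ge0.
- by apply: measurable_funTS; exact: measurable_powRE.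
Qed.

(** Positivity of the constant of the Riesz kernel, on which the lower bound
    depends, needs the Gamma integral to be finite: [euler_gamma] is a real-valued
    integral, and the value assigned to a divergent one is 0. *)
Lemma euler_gamma_gt0 a : 0 < a -> 0 < euler_gamma a.
Proof.
move=> a0; rewrite /euler_gamma /Rintegral; apply: fine_gt0.
rewrite gamma_integral_lty// andbT.
(* on [1, 2] the power is at least 1/t >= 1/2 because a - 1 >= -1 *)
have c0 : 0 < 2^-1 * expR (- 2) :> R by rewrite mulr_gt0 ?expR_gt0.
apply: (@lt_le_trans _ _ (2^-1 * expR (- 2))%:E); first by rewrite lte_fin.
have md D : measurable_fun D (gamma_density a).
  exact: measurable_funTS (measurable_gamma_density a).
apply: (@le_trans _ _ (\int[leb]_(t in `[1%R, 2%R]) gamma_density a t)%E).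
  have <- : (\int[leb]_(t in `[1%R, 2%R]) (2^-1 * expR (- 2))%:E =
     (2^-1 * expR (- 2))%:E)%E.
    rewrite integral_cst//= lebesgue_measure_itv/= lte_fin ltr1n -EFinB.
    by rewrite (_ : 2 - 1 = 1 :> R) ?mule1//; ring.
  apply: ge0_le_integral => //.
  - exact: md.
  - move=> x /=; rewrite in_itv/= => /andP[x1 x2].
    rewrite lee_fin ler_pM ?expR_ge0//; last by rewrite ler_expR lerN2.
    have x0 : 0 < x by rewrite (lt_le_trans ltr01).
    apply: (@le_trans _ _ (x `^ (-1))).
      by rewrite (powR_inv1 (ltW x0)) lef_pV2 ?posrE.
    by apply: ler_powR => //; rewrite lerBrDl subrr ltW.
apply: ge0_subset_integral => //.
- exact: md.
- by move=> x _; exact: gamma_density_ge0.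
- by move=> x /=; rewrite !in_itv/= andbT => /andP[x1 _]; rewrite (lt_le_trans ltr01).
Qed.

End gamma_function.

Local Open Scope ereal_scope.

Section negative_power.
Context (R : realType).
Variables (a : R) (a0 : (a < 0)%R).
Local Open Scope ring_scope.

Lemma powR_neg_lt (x y : R) : 0 < x -> x < y -> y `^ a < x `^ a.
Proof.
move=> x0 xy; have y0 := lt_trans x0 xy.
rewrite -(opprK a) !(powRN _ (- a)) ltf_pV2 ?posrE ?powR_gt0//.
by apply: gt0_ltr_powR => //; rewrite ?oppr_gt0// nnegrE ltW.
Qed.

Lemma powR_neg_le (x y : R) : 0 < x -> x <= y -> y `^ a <= x `^ a.
Proof.
by move=> x0; rewrite le_eqVlt => /predU1P[->//|/(powR_neg_lt x0)/ltW].
Qed.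

Lemma powR_invK (x : R) : 0 < x -> (x `^ a^-1) `^ a = x.
Proof. by move=> x0; rewrite -powRrM mulVf ?lt_eqF// powRr1// ltW. Qed.

Lemma powRK_inv (x : R) : 0 < x -> (x `^ a) `^ a^-1 = x.
Proof. by move=> x0; rewrite -powRrM mulfV ?lt_eqF// powRr1// ltW. Qed.

End negative_power.

Lemma powR_neg_gt (R : realType) (a s l : R) : (a < 0)%R -> (0 < s)%R -> (0 < l)%R ->
  (l < s `^ a)%R = (s < l `^ a^-1)%R.
Proof.
move=> a0 s0 l0; apply/idP/idP => h.
- have a'0 : (a^-1 < 0)%R by rewrite invr_lt0.
  by rewrite -[ltLHS](powRK_inv a0 s0) (powR_neg_lt a'0).
- by rewrite -[ltLHS](powR_invK a0 l0) (powR_neg_lt a0).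
Qed.

Local Close Scope ereal_scope.

(** * The Stieltjes transform *)

Local Open Scope ereal_scope.

Section stieltjes.
Context (R : realType) (alpha : R).
Hypothesis alpha1 : (1 < alpha)%R.
Implicit Types (u v w : line R -> \bar R) (r s t l : R).
Let a : R := (alpha^-1 - 1)%R.
Notation S := (stieltjes alpha).

Let a0 : (a < 0)%R.
Proof. by rewrite subr_lt0 invf_lt1// (lt_trans ltr01). Qed.

(** The transform is the integral against max(s, t)^a.  The superlevel sets of this
    kernel are intervals ]0, r[, hence the transform sees its argument only through
    the integrals over such intervals. *)
Definition skernel t (s : line R) : \bar R := (Num.max (s : R) t `^ a)%:E.

Lemma skernel_ge0 t (s : line R) : 0 <= skernel t s.
Proof. by rewrite lee_fin powR_ge0. Qed.

Lemma skernel_le t t' (s : R) : (0 < t)%R -> (t <= t')%R ->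
  skernel t' s <= skernel t s.
Proof.
move=> t0 tt'; rewrite lee_fin; apply: (powR_neg_le a0).
  by rewrite lt_max t0 orbT.
by rewrite ge_max !le_max lexx tt' orbT.
Qed.

Lemma mplus_skernel t : (0 < t)%R -> mplus (@halfline R) (skernel t).
Proof.
move=> t0; split => [|s _]; last exact: skernel_ge0.
apply: measurable_fun_nonincreasing => s s' s0 ss'; rewrite lee_fin.
apply: (powR_neg_le a0); first by rewrite lt_max s0.
by rewrite ge_max !le_max ss' lexx orbT.
Qed.

Lemma superlevel_skernel t l : (0 < t)%R -> (0 < l)%R ->
  @halfline R `&` [set s | l%:E < skernel t s] =
  if (t < l `^ a^-1)%R then below (l `^ a^-1)%:E else set0.
Proof.
move=> t0 l0; apply/seteqP.
have m0 (s : R) : (0 < Num.max s t)%R by rewrite lt_max t0 orbT.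
split => s.
  move=> [s0 /=]; rewrite lte_fin (powR_neg_gt a0 (m0 s) l0).
  by rewrite gt_max => /andP[sl tl]; rewrite tl; split => //; rewrite lte_fin.
case: ifPn => // tl [s0]; rewrite lte_fin => sl; split => //=.
by rewrite lte_fin (powR_neg_gt a0 (m0 s) l0) gt_max sl.
Qed.

Lemma stieltjesE u t : mplus (@halfline R) u -> (0 < t)%R ->
  S u t = \int[lebesgue_line R]_(s in @halfline R) (skernel t s * u s).
Proof.
move=> [mu u0] t0.
pose A : set (line R) := [set s | (0 < (s : R) < t)%R].
pose B : set (line R) := [set s | (t < (s : R))%R].
pose C : set (line R) := [set t].
have [mk k0] := mplus_skernel t0.
have mA : measurable A by apply: measurable_line; exact: (measurable_itv `]0%R, t[).
have mB : measurable B.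
  have -> : B = `]t, +oo[%classic.
    by apply/seteqP; split => s; rewrite /B/= in_itv/= andbT.
  by apply: measurable_line; exact: measurable_itv.
have mC : measurable C by apply: measurable_line; exact: measurable_set1.
have ABC : @halfline R = A `|` (B `|` C).
  apply/seteqP; split => s.
    rewrite /halfline/= => s0; have [st|st|st] := ltgtP s t.
    - by left; rewrite /A/= s0.
    - by right; left.
    - by right; right.
  move=> [/andP[]//|[|->//]]; exact: lt_trans.
have AS : A `<=` @halfline R by rewrite ABC; exact: subsetUl.
have BS : B `<=` @halfline R by rewrite ABC => s Bs; right; left.
have mp : measurable_fun (@halfline R) (fun s => skernel t s * u s).
  exact: emeasurable_funM.
have p0 s : @halfline R s -> 0 <= skernel t s * u s.
  by move=> s0; rewrite mule_ge0 ?u0// skernel_ge0.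
have mh := @measurable_halfline R.
have mpS E : E `<=` @halfline R -> measurable_fun E (fun s => skernel t s * u s).
  by move=> ES; exact: measurable_funS mp.
rewrite [in RHS]ABC ge0_integral_setU; last 5 first.
- exact: mA.
- exact: measurableU.
- by rewrite -ABC.
- by rewrite -ABC.
- rewrite disj_set2E; apply/eqP/seteqP; split => // s [/= /andP[_ st] [|]].
    by rewrite /B/= ltNge (ltW st).
  by move=> ts; move: st; rewrite ts ltxx.
rewrite (@ge0_integral_setU _ _ _ _ B C); last 5 first.
- exact: mB.
- exact: mC.
- by apply: mpS; rewrite ABC; exact: subsetUr.
- by move=> s sBC; apply: p0; rewrite ABC; right.
- rewrite disj_set2E; apply/eqP/seteqP; split => // s [/= + ts].
  by rewrite ts /B/= ltxx.
rewrite [X in _ + (_ + X)]null_set_integral; last 3 first.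
- exact: mC.
- by apply: mpS => s ->.
- by rewrite lebesgue_lineE; exact: lebesgue_measure_set1.
have -> : \int[lebesgue_line R]_(s in A) (skernel t s * u s) =
    (t `^ a)%:E * \int[lebesgue_line R]_(s in A) u s.
  rewrite -ge0_integralZl_EFin; last 4 first.
  - exact: mA.
  - by move=> s /AS; exact: u0.
  - exact: measurable_funS mu.
  - exact: powR_ge0.
  apply: eq_integral => s /set_mem/andP[s0 st].
  by rewrite /skernel max_r// ltW.
have -> : \int[lebesgue_line R]_(s in B) (skernel t s * u s) =
    \int[lebesgue_line R]_(s in B) (u s * ((s : R) `^ a)%:E).
  apply: eq_integral => s /set_mem st.
  by rewrite /skernel muleC max_l// ltW.
by rewrite adde0.
Qed.

Lemma mplus_skernelM u t : mplus (@halfline R) u -> (0 < t)%R ->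
  mplus (@halfline R) (fun s => skernel t s * u s).
Proof.
move=> [mu u0] t0; have [mk k0] := mplus_skernel t0; split.
  exact: emeasurable_funM.
by move=> s s0; rewrite mule_ge0 ?u0// skernel_ge0.
Qed.

Lemma stieltjes_ge0 u t : mplus (@halfline R) u -> (0 < t)%R -> 0 <= S u t.
Proof.
move=> pu t0; rewrite (stieltjesE pu t0); apply: integral_ge0.
exact: (mplus_skernelM pu t0).2.
Qed.

Lemma stieltjes_nonincreasing u s t : mplus (@halfline R) u ->
  (0 < s)%R -> (s <= t)%R -> S u t <= S u s.
Proof.
move=> pu s0 st; have t0 := lt_le_trans s0 st.
rewrite (stieltjesE pu t0) (stieltjesE pu s0).
apply: ge0_le_integral.
- exact: measurable_halfline.
- exact: (mplus_skernelM pu t0).2.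
- exact: (mplus_skernelM pu t0).1.
- exact: (mplus_skernelM pu s0).1.
- move=> r r0; rewrite lee_wpmul2r//; [exact: pu.2|exact: skernel_le].
Qed.

Lemma mplus_stieltjes u : mplus (@halfline R) u -> mplus (@halfline R) (S u).
Proof.
move=> pu; split => [|t t0]; last exact: stieltjes_ge0.
apply: measurable_fun_nonincreasing => s t; exact: stieltjes_nonincreasing.
Qed.

Lemma le_stieltjes u v t : mplus (@halfline R) u -> mplus (@halfline R) v ->
  (forall r, (0 < r)%R -> \int[lebesgue_line R]_(s in below r%:E) u s <=
    \int[lebesgue_line R]_(s in below r%:E) v s) ->
  (0 < t)%R -> S u t <= S v t.
Proof.
move=> pu pv uv t0; rewrite (stieltjesE pu t0) (stieltjesE pv t0).
have pk := mplus_skernel t0.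
apply: (le_integral_layers (@sigma_finite_line R) (@measurable_halfline R)
  (@sigma_finite_line R) (@measurable_halfline R) pk pu pk pv) => l l0.
rewrite superlevel_skernel//; case: ifPn => _; last by rewrite !integral_set0.
by apply: uv; rewrite powR_gt0.
Qed.

Lemma le_stieltjes_pointwise u v t :
  mplus (@halfline R) u -> mplus (@halfline R) v ->
  (forall s, (0 < s)%R -> u s <= v s) -> (0 < t)%R -> S u t <= S v t.
Proof.
move=> pu pv uv t0; apply: le_stieltjes => // r r0; apply: ge0_le_integral.
- exact: measurable_below.
- by move=> s [s0 _]; exact: pu.2.
- by apply: measurable_belowS; exact: pu.1.
- by apply: measurable_belowS; exact: pv.1.
- by move=> s [s0 _]; exact: uv.
Qed.

Lemma stieltjesD u v t : mplus (@halfline R) u -> mplus (@halfline R) v ->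
  (0 < t)%R -> S (fun s => u s + v s) t = S u t + S v t.
Proof.
move=> pu pv t0; have [mu u0] := pu; have [mv v0] := pv.
have puv : mplus (@halfline R) (fun s => u s + v s).
  split; first exact: emeasurable_funD.
  by move=> s s0; rewrite adde_ge0 ?u0 ?v0.
have [mku ku0] := mplus_skernelM pu t0; have [mkv kv0] := mplus_skernelM pv t0.
rewrite (stieltjesE puv t0) (stieltjesE pu t0) (stieltjesE pv t0).
rewrite -ge0_integralD; [|exact: measurable_halfline|by []..].
apply: eq_integral => s /set_mem s0; rewrite ge0_muleDr//; [exact: u0|exact: v0].
Qed.

Lemma stieltjesZ (c : R) u t : (0 <= c)%R -> mplus (@halfline R) u ->
  (0 < t)%R -> S (fun s => c%:E * u s) t = c%:E * S u t.
Proof.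
move=> c0 pu t0; have [mu u0] := pu.
have pcu : mplus (@halfline R) (fun s => c%:E * u s).
  split; first exact: measurable_funeM.
  by move=> s s0; rewrite mule_ge0 ?u0 ?lee_fin.
have [mku ku0] := mplus_skernelM pu t0.
rewrite (stieltjesE pcu t0) (stieltjesE pu t0).
rewrite -ge0_integralZl_EFin; [|exact: measurable_halfline|by []..].
by apply: eq_integral => s _; rewrite muleCA.
Qed.

(** On ]0, r[ the kernel is at least max(r, t)^a. *)
Lemma stieltjes_ge u r t : mplus (@halfline R) u -> (0 < r)%R -> (0 < t)%R ->
  (Num.max r t `^ a)%:E * \int[lebesgue_line R]_(s in below r%:E) u s <= S u t.
Proof.
move=> pu r0 t0; have [mu u0] := pu; rewrite (stieltjesE pu t0).
have mb := @measurable_below R r%:E.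
have [mku ku0] := mplus_skernelM pu t0.
have bS : below r%:E `<=` @halfline R by move=> s [].
rewrite -ge0_integralZl_EFin; last 4 first.
- exact: mb.
- by move=> s /bS; exact: u0.
- exact: measurable_belowS.
- exact: powR_ge0.
apply: (@le_trans _ _ (\int[lebesgue_line R]_(s in below r%:E) (skernel t s * u s))).
  apply: ge0_le_integral.
  - exact: mb.
  - by move=> s /bS s0; rewrite mule_ge0 ?u0// lee_fin powR_ge0.
  - by apply: measurable_funeM; exact: measurable_belowS.
  - exact: measurable_belowS.
  - move=> s [s0]; rewrite lte_fin => sr; rewrite lee_wpmul2r//; first exact: u0.
    rewrite lee_fin; apply: (powR_neg_le a0); first by rewrite lt_max s0.
    by rewrite ge_max !le_max (ltW sr) lexx orbT.
apply: ge0_subset_integral => //; exact: measurable_halfline.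
Qed.

Lemma cvg_stieltjes (u_ : nat -> line R -> \bar R) u t :
  (forall j, mplus (@halfline R) (u_ j)) -> mplus (@halfline R) u ->
  (forall s, (0 < s)%R -> nondecreasing_seq (u_ ^~ s)) ->
  (forall s, (0 < s)%R -> u_ ^~ s @ \oo --> u s) ->
  (0 < t)%R -> S (u_ j) t @[j --> \oo] --> S u t.
Proof.
move=> pu_ pu nd cv t0; rewrite (stieltjesE pu t0).
under eq_fun => j do rewrite (stieltjesE (pu_ j) t0).
have -> : \int[lebesgue_line R]_(s in @halfline R) (skernel t s * u s) =
  \int[lebesgue_line R]_(s in @halfline R) limn (fun j => skernel t s * u_ j s).
  apply: eq_integral => s /set_mem s0; apply/esym/cvg_lim => //.
  by apply: cvgeZl => //; exact: cv.
apply: cvg_monotone_convergence.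
- exact: measurable_halfline.
- by move=> j; exact: (mplus_skernelM (pu_ j) t0).1.
- by move=> j; exact: (mplus_skernelM (pu_ j) t0).2.
- by move=> s s0 i j ij; rewrite lee_wpmul2l ?skernel_ge0//; exact: nd.
Qed.

End stieltjes.

Section stieltjes_bounds.
Context (R : realType).
Implicit Types (a r s t : R).

Lemma integral_lineE (A : set R) (f : R -> \bar R) :
  measurable (A : set (measurableTypeR R)) ->
  measurable_fun (A : set (measurableTypeR R)) f -> (forall x, A x -> 0 <= f x) ->
  \int[lebesgue_line R]_(s in (A : set (line R))) f s =
  \int[@lebesgue_measure R]_(s in A) f s.
Proof.
move=> mA mf f0.
pose phi (s : line R) : measurableTypeR R := s.
have mphi : measurable_fun setT phi by exact: measurable_line_id.
rewrite [RHS](@eq_measure_integral _ _ _ _ (pushforward (lebesgue_line R) phi)).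
  rewrite (@ge0_integral_pushforward _ _ _ _ _ phi mphi (lebesgue_line R) A f).
  - by [].
  - exact: mA.
  - exact: mf.
  - by move=> x /set_mem; exact: f0.
by move=> B mB _; rewrite /pushforward lebesgue_lineE.
Qed.

Lemma integral_below_powR a t : (-1 < a)%R -> (0 < t)%R ->
  \int[lebesgue_line R]_(s in below t%:E) ((s : R) `^ a)%:E <=
  (t `^ (1 + a) / (1 + a))%:E.
Proof.
move=> a1 t0; have -> : below t%:E = `]0%R, t[%classic :> set (line R).
  by apply/seteqP; split => s; rewrite /below/= in_itv/= lte_fin => /andP.
have b0 : (0 < 1 + a)%R by rewrite -ltrBlDl sub0r.
rewrite integral_lineE.
- apply: le_trans (integral_powR_near0 b0 t0).
  rewrite (_ : 1 + a - 1 = a)%R; last by ring.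
  apply: ge0_subset_integral => //.
  + by apply: measurable_funTS; exact: measurable_powRE.
  + by move=> x _; exact: powRE_ge0.
  + by move=> x /=; rewrite !in_itv/= => /andP[-> /ltW].
- exact: measurable_itv.
- by apply: measurable_funTS; exact: measurable_powRE.
- by move=> x _; exact: powRE_ge0.
Qed.

Lemma le_xi (alpha t : R) : (1 < alpha)%R -> (1 <= t)%R ->
  (t `^ (alpha^-1 - 1) <= 2 `^ (1 - alpha^-1) * (t + 1) `^ (alpha^-1 - 1))%R.
Proof.
move=> alpha1 t1; set a := (alpha^-1 - 1)%R.
have a0 : (a < 0)%R by rewrite subr_lt0 invf_lt1// (lt_trans ltr01).
have t0 : (0 < t)%R by rewrite (lt_le_trans ltr01).
rewrite (_ : 1 - alpha^-1 = - a)%R; last by rewrite opprB.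
rewrite powRN mulrC ler_pdivlMr ?powR_gt0// mulrC -powRM//; last exact: ltW.
by apply: (powR_neg_le a0); rewrite ?addr_gt0//; lra.
Qed.

(** The transform of a bounded function of bounded support has the size of xi:
    it is bounded near 0 and decays like t^(1/alpha - 1). *)
Lemma stieltjes_le_xi (alpha r : R) : (1 < alpha)%R -> (0 < r)%R ->
  exists C : R, (0 < C)%R /\ forall u : line R -> \bar R,
    mplus (@halfline R) u -> (forall s : R, (0 < s)%R -> u s <= 1) ->
    (forall s : R, (r <= s)%R -> u s = 0) ->
    forall t : R, (0 < t)%R -> stieltjes alpha u t <= C%:E * xi alpha t.
Proof.
move=> alpha1 r0; set a := (alpha^-1 - 1)%R.
have a0 : (a < 0)%R by rewrite subr_lt0 invf_lt1// (lt_trans ltr01).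
have b0 : (0 < 1 + a)%R by rewrite addrC subrK invr_gt0 (lt_trans ltr01).
pose P : R := (r `^ (1 + a) / (1 + a))%R.
have P0 : (0 < P)%R by rewrite divr_gt0 ?powR_gt0.
exists (2 `^ (1 - alpha^-1) * (r + P))%R; split.
  by rewrite mulr_gt0 ?powR_gt0// addr_gt0.
move=> u pu u1 ur t t0; rewrite (stieltjesE alpha1 pu t0).
have mb := @measurable_below R r%:E.
have [mku ku0] := mplus_skernelM alpha1 pu t0.
have [mk k0] := mplus_skernel alpha1 t0.
have bS : below r%:E `<=` @halfline R by move=> s [].
have -> : \int[lebesgue_line R]_(s in @halfline R) (skernel alpha t s * u s) =
    \int[lebesgue_line R]_(s in below r%:E) (skernel alpha t s * u s).
  rewrite integral_mkcond [RHS]integral_mkcond; apply: eq_integral => s _.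
  rewrite /patch; case: ifPn => [/set_mem s0|s0]; case: ifPn => [/set_mem sr|sr] //.
    rewrite ur ?mule0// leNgt; apply/negP => sr'; move/negP: sr; apply.
    by apply/mem_set; split => //; rewrite lte_fin.
  by move: s0 => /negP; rewrite inE; case; case: sr.
have le_int (g : line R -> \bar R) : measurable_fun (below r%:E) g ->
    (forall s : R, below r%:E s -> skernel alpha t s <= g s) ->
    \int[lebesgue_line R]_(s in below r%:E) (skernel alpha t s * u s) <=
    \int[lebesgue_line R]_(s in below r%:E) g s.
  move=> mg hg; apply: ge0_le_integral.
  - exact: mb.
  - by move=> s /bS; exact: ku0.
  - exact: measurable_belowS.
  - exact: mg.
  - move=> s sb; apply: le_trans (hg _ sb).
    by rewrite -[leRHS]mule1 lee_wpmul2l ?k0 ?u1//; [exact: bS|exact: (bS _ sb)].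
rewrite /xi -/a; have [t1|t1] := leP 1%R t.
- apply: (@le_trans _ _ (t `^ a * r)%:E).
    rewrite EFinM -[X in _ * X](lebesgue_below (a := r%:E)) ?lee_fin ?(ltW r0)//.
    rewrite -integral_cst//; apply: le_int; first exact: measurable_cst.
    move=> s [s0 _]; rewrite lee_fin; apply: (powR_neg_le a0) => //.
    by rewrite le_max lexx orbT.
  rewrite -EFinM lee_fin mulrAC ler_pM ?powR_ge0 ?(ltW r0) ?le_xi//.
  by rewrite lerDl ltW.
- apply: (@le_trans _ _ P%:E).
    have a1 : (-1 < a)%R by rewrite -subr_gt0 opprK addrC.
    apply: le_trans (integral_below_powR a1 r0); apply: le_int.
      by apply: measurable_funTS; apply/measurable_EFinP;
         apply: (measurableT_comp (measurable_powR a)); exact: measurable_line_id.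
    move=> s [s0 _]; rewrite lee_fin; apply: (powR_neg_le a0) => //.
    by rewrite le_max lexx.
  rewrite -EFinM lee_fin mulrAC -[leLHS]mul1r ler_pM ?(ltW P0)//; last by rewrite lerDr ltW.
  apply: (@le_trans _ _ (2 `^ (1 - alpha^-1) * (1 + 1) `^ a)%R).
    rewrite (_ : 1 - alpha^-1 = - a)%R; last by rewrite opprB.
    by rewrite powRN mulVf// gt_eqF ?powR_gt0.
  rewrite ler_pM2l ?powR_gt0//; apply: (powR_neg_le a0); rewrite ?addr_gt0//.
  by rewrite lerD2r ltW.
Qed.

(** Together with [stieltjes_le_xi]: xi is, up to a factor, the transform of the
    characteristic function of a bounded interval. *)
Lemma xi_le_stieltjes (alpha t : R) (u : line R -> \bar R) : (1 < alpha)%R ->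
  mplus (@halfline R) u -> (forall s : R, (0 < s < 1)%R -> 1 <= u s) ->
  (0 < t)%R -> xi alpha t <= stieltjes alpha u t.
Proof.
move=> alpha1 pu u1 t0.
have a0 : (alpha^-1 - 1 < 0)%R by rewrite subr_lt0 invf_lt1// (lt_trans ltr01).
apply: le_trans (stieltjes_ge alpha1 pu ltr01 t0).
apply: (@le_trans _ _ ((Num.max 1 t `^ (alpha^-1 - 1))%:E * 1)).
  rewrite mule1 lee_fin; apply: (powR_neg_le a0); first by rewrite lt_max ltr01.
  by rewrite ge_max lerDr lerDl ler01 ltW.
rewrite lee_wpmul2l ?lee_fin ?powR_ge0//.
rewrite -[leLHS](lebesgue_below (a := 1%:E)) ?lee_fin//.
rewrite -[leLHS]mul1e -integral_cst; last exact: measurable_below.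
apply: ge0_le_integral.
- exact: measurable_below.
- by [].
- exact: measurable_cst.
- by apply: measurable_belowS; exact: pu.1.
- by move=> s [s0]; rewrite lte_fin => s1; apply: u1; rewrite s0.
Qed.

End stieltjes_bounds.

Local Close Scope ereal_scope.

(** * Cubes and Lebesgue measure on the space *)

Section euclidean_measure.
Context (R : realType).
Implicit Types (n : nat) (r t : R).
Notation leb := (@lebesgue_measure R).
Local Open Scope ereal_scope.

Lemma sigma_finite_euclid n : sigma_finite setT (lebesgue_euclid R n).
Proof.
apply: completed_measure_extension_sigma_finite.
exact: sigma_finiteT.
Qed.

Lemma measurable_euclid n (A : set (n.-tuple (measurableTypeR R))) :
  measurable A -> measurable (A : set (euclid R n)).
Proof. by move=> mA; apply: sub_caratheodory; exact: sub_sigma_algebra. Qed.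

Lemma measurable_euclid_id n :
  measurable_fun [set: euclid R n] (fun x => (x : n.-tuple (measurableTypeR R))).
Proof. by move=> _ B mB; rewrite setTI; exact: measurable_euclid. Qed.

Lemma lebesgue_euclidE n (A : set (n.-tuple (measurableTypeR R))) :
  measurable A -> lebesgue_euclid R n (A : set (euclid R n)) = borel_lebesgue R n A.
Proof. exact: measurable_mu_extE. Qed.

Definition box n (A : 'I_n -> set R) : set (n.-tuple (measurableTypeR R)) :=
  [set y | forall i, A i (tnth y i)].

Lemma measurable_box n (A : 'I_n -> set R) :
  (forall i, measurable (A i : set (measurableTypeR R))) -> measurable (box A).
Proof.
move=> mA; have -> : box A =
    \bigcap_(i in [set: 'I_n]) ((fun y : n.-tuple (measurableTypeR R) => tnth y i) @^-1` A i).
  by apply/seteqP; split => y h i; [move=> _; exact: h|exact: (h i)].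
apply: fin_bigcap_measurable; first exact: finite_finset.
move=> i _; rewrite -[X in measurable X]setTI.
exact: (measurable_tnth i measurableT (mA i)).
Qed.

Lemma measure_box n (A : 'I_n -> set R) :
  (forall i, measurable (A i : set (measurableTypeR R))) ->
  borel_lebesgue R n (box A) = \prod_(i < n) leb (A i).
Proof.
elim: n A => [|n IH] A mA.
  rewrite big_ord0 /= diracE mem_set//.
  by case.
rewrite big_ord_recl -IH; last by [].
rewrite /= /prod_tcons /pushforward.
have -> : @tcons R n @^-1` box A = A ord0 `*` box (fun i => A (lift ord0 i)).
  apply/seteqP; split => -[u y] /=.
    move=> h; split => [|i]; first by have := h ord0; rewrite tnth0.
    by have := h (lift ord0 i); rewrite tnthS.
  move=> [hu hy] i; have [->|[j ->]] : i = ord0 \/ exists j, i = lift ord0 j.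
    by case: (unliftP ord0 i) => [j ->|->]; [right; exists j|left].
  - by rewrite tnth0.
  - by rewrite tnthS; exact: hy.
by rewrite product_measure1E//; exact: measurable_box.
Qed.

End euclidean_measure.

Section gauge.
Context (R : realType).
Local Open Scope ring_scope.

Definition supnorm n (y : n.-tuple R) : R := \big[Num.max/0]_(i < n) `|tnth y i|.

Lemma supnorm_ge0 n (y : n.-tuple R) : 0 <= supnorm y.
Proof. exact: bigmax_ge_id. Qed.

Lemma supnorm_ltP n (y : n.-tuple R) (r : R) : 0 < r ->
  supnorm y < r <-> forall i, `|tnth y i| < r.
Proof.
move=> r0; split => [/bigmax_ltP[_ h] i|h]; first exact: h.
by apply/bigmax_ltP; split.
Qed.

(** The volume of the cube centred at 0 whose boundary contains y.  Through this
    map Lebesgue measure on the space becomes Lebesgue measure on the half-line,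
    so a function of the gauge has the rearrangement of its profile; cubes serve
    as well as balls because all norms are equivalent, and their volume needs no
    computation. *)
Definition gauge n (y : n.-tuple R) : R := (2 * supnorm y) ^+ n.

Lemma gauge_ge0 n (y : n.-tuple R) : 0 <= gauge y.
Proof. by rewrite exprn_ge0// mulr_ge0 ?supnorm_ge0. Qed.

Lemma vsubC_supnorm n (x y : n.-tuple R) : supnorm (vsub x y) = supnorm (vsub y x).
Proof. by apply: eq_bigr => i _; rewrite !tnth_mktuple distrC. Qed.

Lemma vsubC_gauge n (x y : n.-tuple R) : gauge (vsub x y) = gauge (vsub y x).
Proof. by rewrite /gauge vsubC_supnorm. Qed.

Definition origin n : n.-tuple R := [tuple 0 | i < n].

Lemma gauge_origin n (y : n.-tuple R) : gauge (vsub (origin n) y) = gauge y.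
Proof.
rewrite vsubC_gauge /gauge; congr ((_ * _) ^+ _); apply: eq_bigr => i _.
by rewrite !tnth_mktuple subr0.
Qed.

Lemma root_exprn n (t : R) : (0 < n)%N -> 0 <= t -> (t `^ n%:R^-1) ^+ n = t.
Proof.
move=> n0 t0; rewrite -powR_mulrn ?powR_ge0// -powRrM mulVf ?pnatr_eq0 -?lt0n//.
by rewrite powRr1.
Qed.

Lemma gauge_ltP n (y : n.-tuple R) (t : R) : (0 < n)%N -> 0 < t ->
  gauge y < t <-> forall i, `|tnth y i| < t `^ n%:R^-1 / 2.
Proof.
move=> n0 t0; rewrite -{1}(root_exprn n0 (ltW t0)) /gauge ltr_pXn2r//; last 2 first.
- by rewrite nnegrE mulr_ge0 ?supnorm_ge0.
- by rewrite nnegrE powR_ge0.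
rewrite mulrC -ltr_pdivlMr//; apply: supnorm_ltP.
by rewrite divr_gt0 ?powR_gt0.
Qed.

Local Open Scope ereal_scope.

Section gauge_measure.
Context (n : nat) (n0 : (0 < n)%N).
Implicit Types (x y : n.-tuple R) (t : R).

Let cube x t (i : 'I_n) : set R :=
  `](tnth x i - t `^ n%:R^-1 / 2)%R, (tnth x i + t `^ n%:R^-1 / 2)%R[%classic.

Let gauge_cube x t : (0 < t)%R -> [set y | (gauge (vsub x y) < t)%R] = box (cube x t).
Proof.
move=> t0; apply/seteqP; split => y.
  move=> /(gauge_ltP _ n0 t0) h i; have := h i; rewrite tnth_mktuple.
  by rewrite /cube/= in_itv/= distrC ltr_distl.
move=> h; apply/(gauge_ltP _ n0 t0) => i; have := h i; rewrite tnth_mktuple.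
by rewrite /cube/= in_itv/= distrC ltr_distl.
Qed.

Lemma measurable_gauge_vsub x t : measurable [set y : euclid R n | (gauge (vsub x y) < t)%R].
Proof.
have [t0|t0] := ltP 0%R t.
  apply: measurable_euclid; rewrite gauge_cube//; apply: measurable_box => i.
  exact: measurable_itv.
rewrite (_ : [set y | _] = set0)//; apply/seteqP; split => // y /= h.
by have := le_lt_trans (gauge_ge0 _) (lt_le_trans h t0); rewrite ltxx.
Qed.

Lemma measure_gauge_vsub x t : (0 < t)%R ->
  lebesgue_euclid R n [set y : euclid R n | (gauge (vsub x y) < t)%R] = t%:E.
Proof.
move=> t0; have mc i : measurable (cube x t i : set (measurableTypeR R)).
  exact: measurable_itv.
rewrite gauge_cube// lebesgue_euclidE ?measure_box//; last exact: measurable_box.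
have e i : true -> lebesgue_measure (cube x t i) = (t `^ n%:R^-1)%:E.
  move=> _; rewrite /cube lebesgue_measure_itv/= lte_fin ltrD2l.
  have c0 : (0 < t `^ n%:R^-1)%R by rewrite powR_gt0.
  rewrite ifT; last by rewrite -subr_gt0 opprK addr_gt0// divr_gt0.
  by rewrite -EFinB; congr EFin; field.
rewrite (eq_bigr _ e) prodEFin prodr_const card_ord.
by rewrite root_exprn// ltW.
Qed.

Lemma measure_gauge t : (0 < t)%R ->
  lebesgue_euclid R n [set y : euclid R n | (gauge y < t)%R] = t%:E.
Proof.
move=> t0; rewrite -[RHS](measure_gauge_vsub (origin n) t0); congr (lebesgue_euclid R n _).
by apply/seteqP; split => y /=; rewrite gauge_origin.
Qed.

Lemma measurable_gauge_vsub_fun x :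
  measurable_fun [set: euclid R n] (fun y => gauge (vsub x y) : measurableTypeR R).
Proof.
apply: (measurability _ (RGenInftyO.measurableE R)) => //= _ [_ [t ->] <-].
rewrite setTI; have := measurable_gauge_vsub x t.
by congr (measurable _); apply/seteqP; split => y /=; rewrite in_itv.
Qed.

Lemma measurable_gauge :
  measurable_fun [set: euclid R n] (fun y => gauge y : measurableTypeR R).
Proof.
have := measurable_gauge_vsub_fun (origin n).
by congr (measurable_fun _ _); apply/funext => y; rewrite gauge_origin.
Qed.

Lemma measurable_gauge_le x t :
  measurable [set y : euclid R n | (gauge (vsub x y) <= t)%R].
Proof.
have := measurable_gauge_vsub_fun x measurableT (measurable_itv `]-oo, t]).
by rewrite setTI; congr (measurable _); apply/seteqP; split => y /=; rewrite in_itv.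
Qed.

Lemma measure_gauge_le x t : (0 <= t)%R ->
  lebesgue_euclid R n [set y : euclid R n | (gauge (vsub x y) <= t)%R] <= t%:E.
Proof.
move=> t0; apply/lee_addgt0Pr => e e0.
rewrite -EFinD -(measure_gauge_vsub x); last by rewrite ltr_wpDl.
apply: le_measure; rewrite ?inE.
- exact: measurable_gauge_le.
- exact: measurable_gauge_vsub.
- by move=> y /= h; rewrite (le_lt_trans h)// ltrDl.
Qed.

Lemma measurable_gauge_below (c : \bar R) :
  measurable [set y : euclid R n | (0 < gauge y)%R /\ (gauge y)%:E < c].
Proof.
have mb : measurable ([set t | (0 < t)%R /\ t%:E < c] : set (measurableTypeR R)).
  apply: is_interval_measurable => s t [s0 _] [_ tc] u /andP[su ut].
  by split; [exact: lt_le_trans su|apply: le_lt_trans tc; rewrite lee_fin].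
by have := measurable_gauge measurableT mb; rewrite setTI.
Qed.

Lemma measure_gauge_below (c : \bar R) : 0 <= c ->
  lebesgue_euclid R n [set y : euclid R n | (0 < gauge y)%R /\ (gauge y)%:E < c] = c.
Proof.
have real_case (t : R) : (0 < t)%R -> lebesgue_euclid R n
    [set y : euclid R n | (0 < gauge y)%R /\ (gauge y)%:E < t%:E] = t%:E.
  move=> t0; pose N : set (euclid R n) := [set y | (gauge (vsub (origin n) y) <= 0)%R].
  have mN : measurable N by exact: measurable_gauge_le.
  transitivity (lebesgue_euclid R n [set y : euclid R n | (gauge y < t)%R]);
    last exact: measure_gauge.
  rewrite -[LHS](measureU0 (B := N))//.
  - congr (lebesgue_euclid R n _); apply/seteqP; split => y /=.
      by move=> [[_ //]|]; rewrite /N/= gauge_origin => /le_lt_trans; exact.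
    by move=> yt; have [y0|y0] := ltP 0%R (gauge y); [left|right; rewrite /N/= gauge_origin].
  - exact: measurable_gauge_below.
  - by apply/eqP; rewrite eq_le measure_ge0 andbT; exact: measure_gauge_le.
case: c => [t| |]//.
  rewrite lee_fin le_eqVlt => /predU1P[<- |/real_case//].
  rewrite [X in lebesgue_euclid R n X](_ : _ = set0) ?measure0//.
  apply/seteqP; split => // y /= [y0]; rewrite lte_fin => y0'.
  by have := lt_trans y0 y0'; rewrite ltxx.
move=> _; apply/eqP; rewrite -leye_eq; apply: lee_above; first exact: measure_ge0.
move=> l l0 _; apply: (@le_trans _ _ (l + 1)%:E); first by rewrite lee_fin lerDl.
rewrite -real_case; last by rewrite ltr_wpDl.
apply: le_measure; rewrite ?inE; [exact: measurable_gauge_below..|].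
by move=> y [y0 _]; split => //; exact: ltry.
Qed.

Section downset.
Variable I : set (line R).
Hypotheses (I0 : I `<=` @halfline R)
  (dI : forall s t : R, (0 < s)%R -> (s <= t)%R -> I t -> I s).

Lemma measurable_gauge_downset :
  measurable [set y : euclid R n | (0 < gauge y)%R /\ I (gauge y)].
Proof.
have mI : measurable (I : set (measurableTypeR R)).
  apply: is_interval_measurable => s t Is It u /andP[su ut].
  by apply: (dI _ ut It); exact: lt_le_trans (I0 Is) su.
have := measurable_gauge measurableT mI; rewrite setTI.
congr (measurable _); apply/seteqP; split => y //=; last by case.
by move=> Iy; split => //; exact: I0.
Qed.

(** A downset agrees with ]0, d[ up to its endpoint d, and the preimage of ]0, d[
    under the gauge is a cube of volume d without its centre. *)
Lemma measure_gauge_downset :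
  lebesgue_euclid R n [set y : euclid R n | (0 < gauge y)%R /\ I (gauge y)] =
  lebesgue_line R I.
Proof.
have [bI Ib] := downset_below I0 dI; apply/eqP; rewrite eq_le; apply/andP; split.
  case dE : (lebesgue_line R I) => [t| |].
  - have t0 : (0 <= t)%R by rewrite -lee_fin -dE measure_ge0.
    apply: le_trans (measure_gauge_le (origin n) t0); apply: le_measure; rewrite ?inE.
    + exact: measurable_gauge_downset.
    + exact: measurable_gauge_le.
    + by move=> y [_ /Ib]; rewrite dE lee_fin /= gauge_origin.
  - exact: leey.
  - have : 0 <= lebesgue_line R I by exact: measure_ge0.
    by rewrite dE.
rewrite -[leLHS]measure_gauge_below; last exact: measure_ge0.
apply: le_measure; rewrite ?inE.
- exact: measurable_gauge_below.
- exact: measurable_gauge_downset.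
- by move=> y [y0 yd]; split => //; apply: bI; split.
Qed.

End downset.

(** The function of the space with profile G, extended by 0 to the null set where
    the gauge vanishes and leaves the half-line. *)
Definition gcomp (G : line R -> \bar R) (y : euclid R n) : \bar R :=
  if (0 < gauge y)%R then G (gauge y) else 0.

Section gcomp.
Variable G : line R -> \bar R.
Hypotheses (pG : mplus (@halfline R) G)
  (niG : forall s t : R, (0 < s)%R -> (s <= t)%R -> G t <= G s).

Lemma gcomp_ge0 y : 0 <= gcomp G y.
Proof. by rewrite /gcomp; case: ifPn => // y0; exact: pG.2. Qed.

Let superlevel_gcomp (l : R) : (0 <= l)%R ->
  [set y | l%:E < gcomp G y] =
  [set y | (0 < gauge y)%R /\ (@halfline R `&` [set s | l%:E < G s]) (gauge y)].
Proof.
move=> l0; apply/seteqP; split => y /=; rewrite /gcomp; case: ifPn => //.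
- by move=> _; rewrite lte_fin ltNge l0.
- by move=> _ [_ []].
- by move=> _ [].
Qed.

Let superlevel_downset (l s t : R) : (0 < s)%R -> (s <= t)%R ->
  (@halfline R `&` [set s | l%:E < G s]) t -> (@halfline R `&` [set s | l%:E < G s]) s.
Proof. by move=> s0 st [t0 /= lt]; split => //=; exact: lt_le_trans lt (niG s0 st). Qed.

Lemma mplus_gcomp : mplus [set: euclid R n] (gcomp G).
Proof.
split => [|y _]; last exact: gcomp_ge0.
apply: (measurability _ (ErealGenOInfty.measurableE R)) => //=.
move=> _ [_ [l ->] <-]; rewrite preimage_itvoy setTI.
have [l0|l0] := leP 0%R l.
  rewrite superlevel_gcomp//; apply: measurable_gauge_downset => [s []//|s t s0 st].
  exact: superlevel_downset.
rewrite (_ : [set x | _] = setT); first exact: measurableT.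
by apply/seteqP; split => y //= _; rewrite (lt_le_trans _ (gcomp_ge0 y))// lte_fin.
Qed.

Lemma distr_gcomp (l : R) : (0 <= l)%R ->
  distr (lebesgue_euclid R n) setT (gcomp G) l =
  distr (lebesgue_line R) (@halfline R) G l.
Proof.
move=> l0; rewrite /distr setTI.
have -> : [set y | l%:E < `|gcomp G y|] = [set y | l%:E < gcomp G y].
  by apply/seteqP; split => y /=; rewrite gee0_abs ?gcomp_ge0.
rewrite superlevel_gcomp// measure_gauge_downset.
- congr (lebesgue_line R _); apply/seteqP.
  by split => s [s0 /=]; rewrite gee0_abs ?pG.2.
- by move=> s [].
- by move=> s t; exact: superlevel_downset.
Qed.

Lemma integral_gcomp :
  \int[lebesgue_euclid R n]_y gcomp G y =
  \int[lebesgue_line R]_(s in @halfline R) G s.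
Proof.
have pg := mplus_gcomp.
apply/eqP; rewrite eq_le; apply/andP; split.
  apply: (le_integral_distr (@sigma_finite_euclid R n) measurableT
    (@sigma_finite_line R) (@measurable_halfline R) pg pG) => l l0.
  by rewrite distr_gcomp// ltW.
apply: (le_integral_distr (@sigma_finite_line R) (@measurable_halfline R)
  (@sigma_finite_euclid R n) measurableT pG pg) => l l0.
by rewrite distr_gcomp// ltW.
Qed.

End gcomp.

End gauge_measure.
End gauge.

(** * Bounds of the Riesz kernel *)

Section norms.
Context (R : realType) (n : nat).
Implicit Types (x y z : n.-tuple R).

Lemma supnorm_le_enorm z : supnorm z <= enorm z.
Proof.
apply: bigmax_le => [|i _]; first exact: sqrtr_ge0.
rewrite -sqrtr_sqr; apply: ler_wsqrtr.
by rewrite (bigD1 i)//= lerDl sumr_ge0// => j _; exact: sqr_ge0.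
Qed.

Lemma enorm_le_supnorm z : enorm z <= Num.sqrt n%:R * supnorm z.
Proof.
rewrite -[X in _ * X]ger0_norm ?supnorm_ge0// -sqrtr_sqr -sqrtrM//.
apply: ler_wsqrtr; rewrite -mulr_natl mulr1 mulr_natl.
rewrite -[X in _ *+ X](card_ord n) -sumr_const; apply: ler_sum => i _.
rewrite -real_normK ?num_real// lerXn2r ?nnegrE ?supnorm_ge0//.
exact: (le_bigmax _ (fun i => `|tnth z i|)).
Qed.

Lemma gauge_vsub_le x y :
  gauge (vsub x y) <= 2 ^+ n * Num.max (gauge x) (gauge y).
Proof.
rewrite /gauge.
have h : supnorm (vsub x y) <= 2 * Num.max (supnorm x) (supnorm y).
  apply: bigmax_le => [|i _]; first by rewrite mulr_ge0// le_max supnorm_ge0.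
  rewrite tnth_mktuple mulr2n mulrDl mul1r (le_trans (ler_normB _ _))// lerD// le_max.
    by rewrite (le_bigmax _ (fun i => `|tnth x i|)).
  by rewrite (le_bigmax _ (fun i => `|tnth y i|)) orbT.
have mono (u v : R) : 0 <= u -> u <= v -> (2 * u) ^+ n <= (2 * v) ^+ n.
  by move=> u0 uv; rewrite lerXn2r ?nnegrE ?mulr_ge0 ?ler_pM2l// (le_trans u0).
apply: (le_trans (mono _ _ (supnorm_ge0 _) h)).
rewrite exprMn ler_pM2l ?exprn_gt0//.
by case: (leP (supnorm x) (supnorm y)) => hxy; rewrite le_max lexx ?orbT.
Qed.

End norms.

Section riesz_kernel_bounds.
Context (R : realType) (n : nat) (gamma : R).
Hypothesis hgamma : 0 < gamma < n%:R.
Let p : R := gamma - n%:R.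
Let a : R := (n%:R / gamma)^-1 - 1.

Let gamma0 : 0 < gamma. Proof. by case/andP: hgamma. Qed.

Lemma riesz_dim_gt0 : (0 < n)%N.
Proof. by rewrite -(ltr_nat R); case/andP: hgamma; exact: lt_trans. Qed.

Lemma riesz_index_gt1 : 1 < n%:R / gamma.
Proof. by rewrite ltr_pdivlMr// mul1r; case/andP: hgamma. Qed.

Let p0 : p < 0. Proof. by rewrite subr_lt0; case/andP: hgamma. Qed.

Let naE : n%:R * a = p.
Proof.
have nn0 : n%:R != 0 :> R by rewrite pnatr_eq0 -lt0n riesz_dim_gt0.
have g0 := gt_eqF gamma0.
by rewrite /a /p; field; rewrite nn0 g0.
Qed.

Lemma riesz_const_gt0 : 0 < riesz_const n gamma.
Proof.
rewrite /riesz_const divr_gt0//.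
  by apply: euler_gamma_gt0; rewrite divr_gt0// subr_gt0; case/andP: hgamma.
apply: mulr_gt0; last by apply: euler_gamma_gt0; rewrite divr_gt0.
by rewrite mulr_gt0// powR_gt0// pi_gt0.
Qed.

Lemma riesz_kernel_ge0 (z : n.-tuple R) : 0 <= riesz_kernel gamma z.
Proof. by rewrite mulr_ge0 ?powR_ge0 ?(ltW riesz_const_gt0). Qed.

Let gauge_powR (z : n.-tuple R) : gauge z `^ a = (2 * supnorm z) `^ p.
Proof.
by rewrite /gauge -powR_mulrn ?mulr_ge0 ?supnorm_ge0// -powRrM naE.
Qed.

Let supnorm_gt0 (z : n.-tuple R) : 0 < gauge z -> 0 < supnorm z.
Proof.
move=> g0; rewrite lt0r supnorm_ge0 andbT; apply/eqP => z0.
by move: g0; rewrite /gauge z0 mulr0 expr0n gtn_eqF ?riesz_dim_gt0// ltxx.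
Qed.

(** The Euclidean norm lies between constant multiples of the maximum norm, whose
    n-th power is the gauge; a power |z|^(gamma - n) is therefore comparable with
    (gauge z)^a.  The kernel is 0 at the origin by convention. *)
Lemma riesz_kernel_le : exists A : R, 0 < A /\
  forall z : n.-tuple R, riesz_kernel gamma z <= A * gauge z `^ a /\
    (gauge z <= 0 -> riesz_kernel gamma z = 0).
Proof.
(* 2^-1 comes from supnorm z = 2^-1 * (2 * supnorm z) *)
exists (riesz_const n gamma * 2^-1 `^ p); split.
  by rewrite mulr_gt0 ?riesz_const_gt0 ?powR_gt0.
move=> z; have K0 : gauge z <= 0 -> riesz_kernel gamma z = 0.
  move=> gz; have z0 : supnorm z <= 0.
    rewrite leNgt; apply/negP => sz; move: gz; apply/negP; rewrite -ltNge.
    by rewrite exprn_gt0// mulr_gt0.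
  rewrite /riesz_kernel (_ : enorm z = 0) ?powR0 ?mulr0 ?lt_eqF//.
  apply/eqP; rewrite eq_le sqrtr_ge0 andbT (le_trans (enorm_le_supnorm z))//.
  by rewrite mulr_ge0_le0// sqrtr_ge0.
split => //; have [gz|gz] := ltP 0 (gauge z); last first.
  by rewrite K0// mulr_ge0 ?powR_ge0// mulr_ge0 ?powR_ge0 ?(ltW riesz_const_gt0).
have z0 := supnorm_gt0 gz.
rewrite gauge_powR -mulrA -powRM ?mulr_ge0 ?supnorm_ge0// mulKf//.
rewrite ler_pM2l ?riesz_const_gt0//; apply: powR_neg_le => //.
exact: supnorm_le_enorm.
Qed.

(** The distance of x and y is at most twice the larger of their norms, and the
    exponent is negative. *)
Lemma riesz_kernel_ge : exists B : R, 0 < B /\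
  forall x y : n.-tuple R, 0 < gauge (vsub x y) -> 0 < gauge x ->
    B * Num.max (gauge y) (gauge x) `^ a <= riesz_kernel gamma (vsub x y).
Proof.
have a0 : a < 0 by rewrite subr_lt0 invf_lt1 ?riesz_index_gt1 ?(lt_trans ltr01 riesz_index_gt1).
have nn0 : 0 < n%:R :> R by rewrite ltr0n riesz_dim_gt0.
have c0 : 0 < Num.sqrt n%:R / 2 :> R by rewrite divr_gt0 ?sqrtr_gt0.
have cp : 0 < riesz_const n gamma * (Num.sqrt n%:R / 2) `^ p.
  by rewrite mulr_gt0 ?riesz_const_gt0 ?powR_gt0.
exists (riesz_const n gamma * (Num.sqrt n%:R / 2) `^ p * (2 ^+ n) `^ a); split.
  by rewrite mulr_gt0// powR_gt0// exprn_gt0.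
move=> x y gxy gx; set m := Num.max _ _.
have m0 : 0 < m by rewrite lt_max gx orbT.
apply: (@le_trans _ _ (riesz_const n gamma * (Num.sqrt n%:R / 2) `^ p
  * gauge (vsub x y) `^ a)).
  rewrite -mulrA ler_pM2l// -powRM ?exprn_ge0 ?(ltW m0)//.
  by apply: (powR_neg_le a0) => //; rewrite /m maxC; exact: gauge_vsub_le.
have z0 := supnorm_gt0 gxy.
rewrite gauge_powR -mulrA -powRM ?(ltW c0) ?mulr_ge0 ?supnorm_ge0//.
rewrite ler_pM2l ?riesz_const_gt0//; apply: (powR_neg_le p0).
  by rewrite (lt_le_trans z0)// supnorm_le_enorm.
by rewrite mulrA divfK// enorm_le_supnorm.
Qed.

Lemma measurable_enorm : measurable_fun setT (@enorm R n : n.-tuple (measurableTypeR R) -> R).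
Proof.
have msqrt : measurable_fun setT (@Num.sqrt R).
  by apply: continuous_measurable_fun; exact: sqrt_continuous.
apply: (measurableT_comp msqrt); apply: measurable_sum => i.
by apply: measurable_funX; exact: measurable_tnth.
Qed.

Lemma measurable_vsub : measurable_fun setT
  (fun z : euclid R n * euclid R n => vsub z.1 z.2 : n.-tuple (measurableTypeR R)).
Proof.
apply/measurable_fun_tnthP => i.
have -> : (@tnth n _ ^~ i) \o (fun z : euclid R n * euclid R n => vsub z.1 z.2) =
    fun z => (tnth (z.1 : n.-tuple R) i - tnth (z.2 : n.-tuple R) i).
  by apply/funext => z /=; rewrite tnth_mktuple.
have mt : measurable_fun setT (fun x : euclid R n => tnth (x : n.-tuple R) i).
  exact: (measurableT_comp (measurable_tnth i) (@measurable_euclid_id R n)).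
by apply: measurable_funB; apply: (measurableT_comp mt).
Qed.

Lemma measurable_riesz_kernel : measurable_fun setT
  (fun z : euclid R n * euclid R n => (riesz_kernel gamma (vsub z.1 z.2))%:E).
Proof.
apply/measurable_EFinP; apply: measurable_funM; first exact: measurable_cst.
apply: (measurableT_comp (measurable_powR _)).
exact: (measurableT_comp measurable_enorm measurable_vsub).
Qed.

Lemma measurable_riesz_kernel_l (x : euclid R n) : measurable_fun setT
  (fun y : euclid R n => (riesz_kernel gamma (vsub x y))%:E).
Proof.
exact: (measurableT_comp measurable_riesz_kernel (measurable_pair1 x)).
Qed.

End riesz_kernel_bounds.

(** * The Riesz potential *)

Local Open Scope ereal_scope.

(** The weak type estimate divides by the measure of a set, which must be finite. *)
Lemma finite_measure_subset d (T : measurableType d) (R : realType)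
    (mu : {measure set T -> \bar R}) (E : set T) (t : R) :
  sigma_finite setT mu -> measurable E -> t%:E < mu E ->
  exists F, [/\ measurable F, F `<=` E, t%:E < mu F & mu F < +oo].
Proof.
move=> /sigma_finiteP[F [FT ndF mF]] mE tE.
pose G k := E `&` F k.
have mG k : measurable (G k) by apply: measurableI => //; exact: (mF k).1.
have GE : \bigcup_k G k = E by rewrite -setI_bigcupr -FT setIT.
have ndG : nondecreasing_seq G.
  by move=> i j ij; apply/subsetPset; apply: setIS; exact/subsetPset/ndF.
have := @nondecreasing_cvg_mu _ _ _ mu G mG (bigcupT_measurable _ mG) ndG.
rewrite GE => cv.
have [k tk] : exists k, t%:E < mu (G k).
  apply: contrapT => /forallNP h; move: tE; apply/negP; rewrite -leNgt.
  apply: (cvge_to_le cv); apply: nearW => k /=.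
  by rewrite leNgt; apply/negP; exact: h.
exists (G k); split => //; first exact: subIsetl.
apply: le_lt_trans (mF k).2; apply: le_measure; rewrite ?inE//.
- exact: (mF k).1.
- exact: subIsetr.
Qed.

Section riesz_potential.
Context (R : realType) (n : nat) (gamma : R).
Hypothesis hgamma : (0 < gamma < n%:R)%R.
Let alpha : R := (n%:R / gamma)%R.
Let a : R := (alpha^-1 - 1)%R.
Let n0 : (0 < n)%N := riesz_dim_gt0 hgamma.
Let alpha1 : (1 < alpha)%R := riesz_index_gt1 hgamma.
Notation mu := (lebesgue_euclid R n).
Notation leb1 := (lebesgue_line R).
Notation K z := (riesz_kernel gamma z)%:E.
Notation I := (@riesz R n gamma).
Implicit Types (f g h : euclid R n -> \bar R) (u : line R -> \bar R) (x y : euclid R n).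

Let a0 : (a < 0)%R.
Proof. by rewrite subr_lt0 invf_lt1// (lt_trans ltr01). Qed.

Let aN1 : (0 < 1 + a)%R.
Proof. by rewrite addrC subrK invr_gt0 (lt_trans ltr01). Qed.

Let K0 (z : n.-tuple R) : 0 <= K z.
Proof. by rewrite lee_fin riesz_kernel_ge0. Qed.

Lemma measurable_riesz_integrand f : measurable_fun setT f -> measurable_fun setT
  (fun z : euclid R n * euclid R n => f z.2 * K (vsub z.1 z.2)).
Proof.
move=> mf; apply: emeasurable_funM; last exact: measurable_riesz_kernel.
exact: (measurableT_comp mf measurable_snd).
Qed.

Lemma measurable_riesz_integrand_l f x : measurable_fun setT f ->
  measurable_fun setT (fun y => f y * K (vsub x y)).
Proof.
by move=> mf; apply: emeasurable_funM; [exact: mf|exact: measurable_riesz_kernel_l].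
Qed.

Lemma measurable_riesz f : measurable_fun setT f -> measurable_fun setT (I f).
Proof.
move=> mf; have mH := measurable_riesz_integrand mf.
pose H (z : euclid R n * euclid R n) := f z.2 * K (vsub z.1 z.2).
have -> : I f = fun x => (\int[mu]_y H^\+ (x, y)) - (\int[mu]_y H^\- (x, y)).
  by apply/funext => x; rewrite /riesz integralE; congr (_ - _);
    apply: eq_integral => y _; rewrite ?funeposE ?funenegE.
apply: emeasurable_funB.
- apply: (measurable_partial_integral (@sigma_finite_euclid R n)).
    exact: measurable_funepos.
  exact: funepos_ge0.
- apply: (measurable_partial_integral (@sigma_finite_euclid R n)).
    exact: measurable_funeneg.
  exact: funeneg_ge0.
Qed.

Lemma riesz_ge0 f x : (forall y, 0 <= f y) -> 0 <= I f x.
Proof. by move=> f0; apply: integral_ge0 => y _; rewrite mule_ge0. Qed.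

(** This covers the points where the potential of f takes a conventional value,
    because there the potential of |f| is infinite. *)
Lemma abse_riesz_le f x : measurable_fun setT f ->
  `|I f x| <= I (fun y => `|f y|) x.
Proof.
move=> mf; apply: le_trans (le_abse_integral _ measurableT _) _.
  exact: measurable_riesz_integrand_l.
rewrite le_eqVlt; apply/orP; left; apply/eqP; apply: eq_integral => y _.
by rewrite abseM (gee0_abs (K0 _)).
Qed.

Lemma rieszD f g x : mplus setT f -> mplus setT g ->
  I (fun y => f y + g y) x = I f x + I g x.
Proof.
move=> [mf f0] [mg g0]; rewrite /riesz -ge0_integralD.
- by apply: eq_integral => y _; rewrite ge0_muleDl ?f0 ?g0.
- exact: measurableT.
- by move=> y _; rewrite mule_ge0 ?f0 ?K0.
- exact: measurable_riesz_integrand_l.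
- by move=> y _; rewrite mule_ge0 ?g0 ?K0.
- exact: measurable_riesz_integrand_l.
Qed.

(** By [riesz_kernel_ge] the kernel at x - y is at least a multiple of
    max(gauge y, gauge x)^a, the kernel of the Stieltjes transform at gauge x; the
    integral over y becomes an integral over the half-line because the integrand
    is a nonincreasing function of gauge y. *)
Lemma stieltjes_le_riesz : exists B : R, (0 < B)%R /\
  forall u, mplus (@halfline R) u ->
    (forall s t : R, (0 < s)%R -> (s <= t)%R -> u t <= u s) ->
    forall x, (0 < gauge x)%R ->
      B%:E * stieltjes alpha u (gauge x) <= I (gcomp u) x.
Proof.
have [B [B0 hB]] := riesz_kernel_ge hgamma.
exists B; split => // u pu niu x gx; rewrite (stieltjesE alpha1 pu gx).
pose w := fun s : line R => skernel alpha (gauge x) s * u s.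
have pw : mplus (@halfline R) w by exact: mplus_skernelM.
have niw s t : (0 < s)%R -> (s <= t)%R -> w t <= w s.
  move=> s0 st; have t0 := lt_le_trans s0 st.
  apply: lee_pmul; [exact: skernel_ge0|exact: pu.2| |exact: niu].
  rewrite lee_fin; apply: (powR_neg_le a0); first by rewrite lt_max s0.
  by rewrite ge_max !le_max st lexx orbT.
rewrite -(integral_gcomp n0 pw niw).
have [mgw gw0] := mplus_gcomp n0 pw niw; have [mgu gu0] := mplus_gcomp n0 pu niu.
rewrite -ge0_integralZl_EFin//; last exact: ltW.
apply: ae_ge0_le_integral.
- exact: measurableT.
- by move=> y _; rewrite mule_ge0 ?gw0// lee_fin ltW.
- exact: measurable_funeM.
- by move=> y _; rewrite mule_ge0 ?gu0 ?K0.
- exact: measurable_riesz_integrand_l.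
(* the kernel vanishes at y = x by convention, so the bound fails there *)
exists [set y | (gauge (vsub x y) <= 0)%R]; split.
- exact: measurable_gauge_le.
- apply/eqP; rewrite eq_le measure_ge0 andbT; exact: measure_gauge_le.
move=> y /=; apply: contra_notP => /negP; rewrite -ltNge => gxy _.
rewrite /gcomp; case: ifPn => gy; last by rewrite mule0 mul0e.
rewrite muleA [leRHS]muleC lee_wpmul2r//; first exact: pu.2.
by rewrite -EFinM lee_fin; exact: hB.
Qed.

Section kernel_superlevel.
Variables (A : R) (A0 : (0 < A)%R).
Hypothesis hA : forall z : n.-tuple R,
  (riesz_kernel gamma z <= A * gauge z `^ a)%R /\
  ((gauge z <= 0)%R -> riesz_kernel gamma z = 0%R).
Let k (s : line R) : \bar R := A%:E * ((s : R) `^ a)%:E.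
Let radius (m : R) : R := ((m / A) `^ a^-1)%R.

Let radius_gt0 m : (0 < m)%R -> (0 < radius m)%R.
Proof. by move=> m0; rewrite powR_gt0// divr_gt0. Qed.

Let pk : mplus (@halfline R) k.
Proof.
split => [|s _]; last by rewrite /k -EFinM lee_fin mulr_ge0 ?powR_ge0 ?(ltW A0).
apply: measurable_fun_nonincreasing => s t s0 st.
by rewrite /k -!EFinM lee_fin ler_pM2l//; exact: (powR_neg_le a0).
Qed.

Let superlevel_k m : (0 < m)%R ->
  @halfline R `&` [set s | m%:E < k s] = below (radius m)%:E.
Proof.
move=> m0; have mA0 : (0 < m / A)%R by rewrite divr_gt0.
apply/seteqP; split => s [s0 /=]; rewrite /k -?EFinM !lte_fin => h; split => //=.
  by rewrite lte_fin -(powR_neg_gt a0 s0 mA0) ltr_pdivrMr// mulrC.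
by rewrite mulrC -ltr_pdivrMr// (powR_neg_gt a0 s0 mA0).
Qed.

Let superlevel_K x m : (0 < m)%R ->
  [set y : euclid R n | m%:E < K (vsub x y)] `<=`
  [set y | (gauge (vsub x y) < radius m)%R].
Proof.
move=> m0 y /=; rewrite lte_fin => h.
have [hle h0] := hA (vsub x y).
have g0 : (0 < gauge (vsub x y))%R.
  rewrite ltNge; apply/negP => /h0 h00; move: h; rewrite h00.
  by rewrite ltNge (ltW m0).
rewrite -(powR_neg_gt a0 g0) ?divr_gt0// ltr_pdivrMr// mulrC.
exact: lt_le_trans h hle.
Qed.

Let measurable_superlevel_K x m : measurable [set y : euclid R n | m%:E < K (vsub x y)].
Proof.
rewrite -[X in measurable X]setTI; apply: emeasurable_fun_o_infty.
  exact: measurableT.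
exact: measurable_riesz_kernel_l.
Qed.

Let measure_superlevel_K x m : (0 < m)%R ->
  mu [set y : euclid R n | m%:E < K (vsub x y)] <= (radius m)%:E.
Proof.
move=> m0; rewrite -(measure_gauge_vsub n0 x (radius_gt0 m0)).
apply: le_measure; rewrite ?inE; [exact: measurable_superlevel_K|
  exact: measurable_gauge_vsub|exact: superlevel_K].
Qed.

(** The rearrangement of the kernel is at most k, since the kernel exceeds m only
    inside a cube of volume [radius m], which is where k exceeds m. *)
Lemma riesz_le_rearr h x : mplus setT h ->
  I h x <= \int[leb1]_(s in @halfline R) (k s * rearr mu setT h s).
Proof.
move=> ph; rewrite /riesz; under eq_integral do rewrite muleC.
have pK : mplus setT (fun y : euclid R n => K (vsub x y)).
  by split => [|y _]; [exact: measurable_riesz_kernel_l|exact: K0].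
apply: (le_integral_layers (@sigma_finite_euclid R n) measurableT
  (@sigma_finite_line R) (@measurable_halfline R) pK ph pk (mplus_rearr _ _ _)).
move=> m m0; rewrite superlevel_k// setTI.
apply: integral_le_below_rearr.
- exact: sigma_finite_euclid.
- exact: measurableT.
- exact: measurable_superlevel_K.
- exact: subsetT.
- exact: ph.
- exact: radius_gt0.
- exact: measure_superlevel_K.
Qed.

Lemma riesz_kernelC (x y : n.-tuple R) :
  riesz_kernel gamma (vsub x y) = riesz_kernel gamma (vsub y x).
Proof.
rewrite /riesz_kernel /enorm; congr (_ * Num.sqrt _ `^ _)%R.
by apply: eq_bigr => i _; rewrite !tnth_mktuple -sqrrN opprB.
Qed.

(** Among the sets of measure r the kernel has the largest integral over a cube
    centred at its pole, and this integral is that of k over ]0, r[. *)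
Lemma integral_riesz_kernel_le (E : set (euclid R n)) y (r : R) :
  measurable E -> (0 < r)%R -> mu E <= r%:E ->
  \int[mu]_(x in E) K (vsub x y) <= (A * (r `^ (1 + a) / (1 + a)))%:E.
Proof.
move=> mE r0 Er; under eq_integral do rewrite riesz_kernelC.
have mb := @measurable_below R r%:E.
have bS : below r%:E `<=` @halfline R by move=> s [].
have pkb : mplus (below r%:E) k.
  by split; [apply: measurable_belowS; exact: pk.1|move=> s /bS; exact: pk.2].
apply: (@le_trans _ _ (\int[leb1]_(s in below r%:E) k s)).
  have pK : mplus E (fun x : euclid R n => K (vsub y x)).
    split => [|x _]; last exact: K0.
    by apply: measurable_funTS; exact: measurable_riesz_kernel_l.
  apply: (le_integral_distr (@sigma_finite_euclid R n) mE
    (@sigma_finite_line R) mb pK pkb).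
  move=> m m0; rewrite /distr.
  have -> : below r%:E `&` [set s | m%:E < `|k s|] = below (Num.min r (radius m))%:E.
    have -> : [set s | m%:E < `|k s|] = [set s | m%:E < k s].
      by apply/eq_set => s; rewrite gee0_abs// /k -EFinM lee_fin mulr_ge0 ?powR_ge0 ?ltW.
    rewrite -(setIidl bS) -setIA superlevel_k//.
    apply/seteqP; split => s; rewrite /below/= !lte_fin lt_min.
      by move=> [[s0 ->] [_ ->]].
    by move=> [s0 /andP[-> ->]].
  have rm0 := radius_gt0 m0.
  rewrite lebesgue_below; last by rewrite lee_fin le_min !ltW.
  have -> : E `&` [set x | m%:E < `|K (vsub y x)|] = E `&` [set x | m%:E < K (vsub y x)].
    by congr (_ `&` _); apply/eq_set => x; rewrite gee0_abs// K0.
  have mK := measurable_superlevel_K y m.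
  rewrite EFin_min le_min; apply/andP; split.
    by apply: le_trans Er; apply: le_measure; rewrite ?inE//; exact: measurableI.
  apply: le_trans (measure_superlevel_K y m0).
  by apply: le_measure; rewrite ?inE//; exact: measurableI.
rewrite /k ge0_integralZl_EFin.
- rewrite EFinM lee_wpmul2l ?lee_fin ?(ltW A0)//.
  by apply: integral_below_powR => //; rewrite -subr_gt0 opprK addrC.
- exact: mb.
- by move=> s _; exact: powRE_ge0.
- apply: measurable_funTS; apply/measurable_EFinP.
  by apply: (measurableT_comp (measurable_powR a)); exact: measurable_line_id.
- exact: ltW.
Qed.

Lemma integral_riesz_le (E : set (euclid R n)) g (r : R) : mplus setT g ->
  measurable E -> (0 < r)%R -> mu E <= r%:E ->
  \int[mu]_(x in E) I g x <=
  (A * (r `^ (1 + a) / (1 + a)))%:E * \int[mu]_y g y.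
Proof.
move=> [mg g0] mE r0 Er.
pose H : euclid R n * euclid R n -> \bar R :=
  (fun z => g z.2 * K (vsub z.1 z.2)) \_ (fst @^-1` E).
have mfE : measurable (fst @^-1` E : set (euclid R n * euclid R n)).
  have := @measurable_fst _ _ (euclid R n) (euclid R n) measurableT _ mE.
  by rewrite setTI.
have mH : measurable_fun setT H.
  apply: (measurable_restrictT _ mfE).1.
  exact: (measurable_funTS (measurable_riesz_integrand mg)).
have H0 z : 0 <= H z.
  by apply: erestrict_ge0 => z' _; rewrite mule_ge0 ?g0 ?K0.
have -> : \int[mu]_(x in E) I g x = \int[mu]_x \int[mu]_y H (x, y).
  rewrite integral_mkcond; apply: eq_integral => x _.
  rewrite /H /patch /=; case: ifPn => [xE|xE].
    by apply: eq_integral => y _; rewrite ifT//; apply/mem_set; exact: set_mem xE.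
  rewrite [RHS]integral0_eq// => y _; rewrite ifF//; apply/negbTE.
  by move/negP: xE => xE; apply/negP => /set_mem h; apply: xE; apply/mem_set.
rewrite (tonelli (@sigma_finite_euclid R n) (@sigma_finite_euclid R n) mH H0).
have c0 : (0 <= A * (r `^ (1 + a) / (1 + a)))%R.
  by rewrite mulr_ge0 ?divr_ge0 ?powR_ge0 ?ltW.
rewrite -ge0_integralZl_EFin; [|exact: measurableT|by []..].
have mKy y : measurable_fun E (fun x : euclid R n => K (vsub x y)).
  apply: measurable_funTS; under eq_fun do rewrite riesz_kernelC.
  exact: measurable_riesz_kernel_l.
have HE y : \int[mu]_x H (x, y) = g y * \int[mu]_(x in E) K (vsub x y).
  rewrite -ge0_integralZl//; last exact: g0.
  rewrite [RHS]integral_mkcond; apply: eq_integral => x _.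
  by rewrite /H /patch /=; congr (if _ then _ else _); apply/idP/idP => /set_mem h;
    apply/mem_set.
apply: ge0_le_integral.
- exact: measurableT.
- by move=> y _; apply: integral_ge0 => x _; exact: H0.
- have mH' : measurable_fun setT (H \o (fun z : euclid R n * euclid R n => (z.2, z.1))).
    apply: (measurableT_comp mH); exact: measurable_swap.
  by apply: (measurable_partial_integral (@sigma_finite_euclid R n) mH') => z; exact: H0.
- exact: measurable_funeM.
- move=> y _; rewrite HE muleC lee_wpmul2r ?g0//.
  exact: integral_riesz_kernel_le.
Qed.

(** If the potential exceeded lam on a set of measure m > t, then integrating it
    over that set would give lam m <= C m^(1 + a) int g, that is
    lam <= C m^a int g, while m^a < t^a. *)
Lemma riesz_weak_type g (t lam : R) : mplus setT g -> (0 < t)%R ->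
  (A / (1 + a) * t `^ a)%:E * \int[mu]_y g y < lam%:E ->
  mu [set x | lam%:E < I g x] <= t%:E.
Proof.
move=> pg t0 hlam; have [mg g0] := pg.
have ig0 : 0 <= \int[mu]_y g y by apply: integral_ge0 => y _; exact: g0.
have C0 : (0 < A / (1 + a) * t `^ a)%R by rewrite mulr_gt0 ?divr_gt0 ?powR_gt0.
have mI : measurable_fun setT (I g) by exact: measurable_riesz.
have mE0 : measurable [set x | lam%:E < I g x].
  by rewrite -[X in measurable X]setTI; apply: emeasurable_fun_o_infty.
rewrite leNgt; apply/negP => /(finite_measure_subset (@sigma_finite_euclid R n) mE0).
move=> [E [mE EE0 tE Eoo]].
case gE : (\int[mu]_y g y) ig0 hlam => [G| |] //.
  rewrite lee_fin -EFinM lte_fin => G0 hlam.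
  have fE : mu E \is a fin_num by rewrite ge0_fin_numE// measure_ge0.
  pose m := fine (mu E); have mEm : mu E = m%:E by rewrite /m fineK.
  have tm : (t < m)%R by rewrite -lte_fin -mEm.
  have m0 : (0 < m)%R := lt_trans t0 tm.
  have : lam%:E * m%:E <= (A * (m `^ (1 + a) / (1 + a)))%:E * G%:E.
    rewrite -gE -mEm -integral_cst//.
    apply: le_trans (integral_riesz_le pg mE m0 _); last by rewrite mEm.
    apply: ge0_le_integral.
    - exact: mE.
    - move=> x _; rewrite lee_fin ltW// (le_lt_trans _ hlam)// mulr_ge0//.
      exact: ltW.
    - exact: measurable_cst.
    - exact: measurable_funTS.
    - by move=> x /EE0 /ltW.
  rewrite -!EFinM lee_fin powRD ?(gt_eqF m0) ?implybT// powRr1 ?(ltW m0)//.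
  rewrite (_ : A * _ * G = A / (1 + a) * m `^ a * G * m)%R; last by field; rewrite gt_eqF.
  rewrite ler_pM2r//; apply/negP; rewrite -ltNge; apply: le_lt_trans hlam.
  rewrite ler_wpM2r// ler_pM2l ?divr_gt0//; apply: (powR_neg_le a0) => //.
  exact: ltW.
by rewrite gt0_muley ?lte_fin.
Qed.

(** The rearrangement of min(f, lam) is at most lam before t and at most f* after
    t.  Before t the integral against k is a multiple of lam t^(1 + a), which is
    at most t^a times the integral of f* over ]0, t[; after t it is part of the
    transform. *)
Lemma riesz_truncated_le f (t lam : R) x : mplus setT f -> (0 < t)%R ->
  rearr mu setT f t = lam%:E ->
  I (fun y => mine (f y) lam%:E) x <=
  (A / (1 + a) + A)%:E * stieltjes alpha (rearr mu setT f) t.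
Proof.
move=> pf t0 fl; have [mf f0] := pf; set u := rearr mu setT f.
have pu : mplus (@halfline R) u by exact: mplus_rearr.
have lam0 : (0 <= lam)%R by rewrite -lee_fin -fl rearr_ge0.
set h := fun y => mine (f y) lam%:E.
have ph : mplus setT h.
  split => [|y Dy]; last by rewrite le_min f0.
  by apply: measurable_mine => //; exact: measurable_cst.
have S0 : 0 <= stieltjes alpha u t by exact: stieltjes_ge0.
apply: le_trans (riesz_le_rearr x ph) _.
have mb := @measurable_below R t%:E.
have mpow (D : set (line R)) : measurable_fun D (fun s : line R => ((s : R) `^ a)%:E).
  apply: measurable_funTS; apply/measurable_EFinP.
  by apply: (measurableT_comp (measurable_powR a)); exact: measurable_line_id.
(* the bound of the integrand before t *)
pose v : line R -> \bar R :=
  (fun s : line R => (A * lam)%:E * ((s : R) `^ a)%:E) \_ (below t%:E).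
have v0 s : 0 <= v s.
  by apply: erestrict_ge0 => s' _; rewrite -EFinM lee_fin ?mulr_ge0 ?powR_ge0 ?(ltW A0).
have mv : measurable_fun (@halfline R) v.
  apply: measurable_funTS; apply: (measurable_restrictT _ mb).1.
  exact: measurable_funeM (mpow _).
have [mku ku0] := mplus_skernelM alpha1 pu t0.
have mh := @measurable_halfline R.
apply: (@le_trans _ _ (\int[leb1]_(s in @halfline R)
    (v s + A%:E * (skernel alpha t s * u s)))).
  have pr := mplus_rearr mu setT h.
  apply: ge0_le_integral.
  - exact: mh.
  - by move=> s s0; rewrite mule_ge0 ?pk.2 ?pr.2.
  - by apply: emeasurable_funM; [exact: pk.1|exact: pr.1].
  - by apply: emeasurable_funD; [exact: mv|exact: measurable_funeM mku].
  - move=> s s0.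
    have hu : rearr mu setT h s <= u s.
      apply: le_rearr_ae; [exact: measurableT|exact: ph.1|exact: mf|].
      by apply: aeW => y _; rewrite !gee0_abs ?ph.2 ?f0// ge_min lexx.
    have hlam : rearr mu setT h s <= lam%:E.
      apply/(rearr_leP mu measurableT s ph.1 lam0).
      rewrite /distr (_ : setT `&` _ = set0) ?measure0 ?lee_fin ?(ltW s0)//.
      apply/seteqP; split => // y [_ /=]; rewrite gee0_abs ?ph.2//.
      by rewrite ltNge ge_min lexx orbT.
    have [st|st] := ltP s t.
      rewrite /v patchE ifT; last by apply/mem_set; split => //; rewrite lte_fin.
      rewrite -[leLHS]adde0; apply: leeD; last first.
        by rewrite mule_ge0 ?ku0// lee_fin (ltW A0).
      rewrite /k EFinM [leRHS]muleAC lee_wpmul2l//.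
      by rewrite -EFinM lee_fin mulr_ge0 ?powR_ge0 ?(ltW A0).
    rewrite -[leLHS]add0e; apply: leeD; first exact: v0.
    rewrite /k /skernel max_l// muleA lee_wpmul2l//.
    by rewrite -EFinM lee_fin mulr_ge0 ?powR_ge0 ?(ltW A0).
rewrite ge0_integralD; last 5 first.
- exact: mh.
- by move=> s _; exact: v0.
- exact: mv.
- by move=> s s0; rewrite mule_ge0 ?ku0// lee_fin (ltW A0).
- exact: measurable_funeM mku.
rewrite EFinD ge0_muleDl ?lee_fin ?divr_ge0 ?(ltW A0) ?(ltW aN1)//; apply: leeD; last first.
  rewrite ge0_integralZl_EFin; last 4 first.
  - exact: mh.
  - exact: ku0.
  - exact: mku.
  - exact: ltW.
  by rewrite -(stieltjesE alpha1 pu t0).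
have -> : \int[leb1]_(s in @halfline R) v s =
    (A * lam)%:E * \int[leb1]_(s in below t%:E) ((s : R) `^ a)%:E.
  rewrite -ge0_integralZl_EFin; last 4 first.
  - exact: mb.
  - by move=> s _; exact: powRE_ge0.
  - exact: mpow.
  - by rewrite mulr_ge0 ?(ltW A0).
  rewrite [LHS]integral_mkcond [RHS]integral_mkcond.
  apply: eq_integral => s _.
  rewrite /v /patch; case: (boolP (s \in below t%:E)) => [/set_mem[s0 _]|_].
    by rewrite mem_set.
  by case: ifP.
apply: (@le_trans _ _ ((A * lam)%:E * (t `^ (1 + a) / (1 + a))%:E)).
  rewrite lee_wpmul2l ?lee_fin ?mulr_ge0 ?(ltW A0)//.
  by apply: integral_below_powR => //; rewrite -subr_gt0 opprK addrC.
rewrite powRD ?(gt_eqF t0) ?implybT// powRr1 ?(ltW t0)//.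
have -> : ((A * lam)%:E * (t * t `^ a / (1 + a))%:E =
    (A / (1 + a))%:E * ((t `^ a)%:E * (lam%:E * t%:E))).
  by rewrite -!EFinM; congr EFin; field; rewrite gt_eqF.
rewrite lee_wpmul2l ?lee_fin ?divr_ge0 ?(ltW A0) ?(ltW aN1)//.
apply: le_trans (stieltjes_ge alpha1 pu t0 t0); rewrite maxxx.
rewrite lee_wpmul2l ?lee_fin ?powR_ge0// -fl.
by apply: below_ge => // s s' _; exact: rearr_nonincreasing.
Qed.

(** O'Neil's inequality.  At the level lam = f*(t) the function splits into a
    bounded part, whose potential is bounded everywhere by comparing
    rearrangements, and an integrable part, controlled by the weak type
    estimate outside a set of measure t. *)
Lemma rearr_riesz_le_of_kernel f (t : R) : mplus setT f -> (0 < t)%R ->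
  rearr mu setT (I f) t <=
  (A / (1 + a) + A + A / (1 + a))%:E * stieltjes alpha (rearr mu setT f) t.
Proof.
move=> pf t0; have [mf f0] := pf; set u := rearr mu setT f.
have pu : mplus (@halfline R) u by exact: mplus_rearr.
have niu (s s' : R) : (0 < s)%R -> (s <= s')%R -> u s' <= u s.
  by move=> _; exact: rearr_nonincreasing.
set C1 : R := (A / (1 + a) + A)%R; set C2 : R := (A / (1 + a))%R.
have C20 : (0 < C2)%R by rewrite divr_gt0.
have C10 : (0 < C1)%R by rewrite addr_gt0.
have C0 : (0 < C1 + C2)%R by rewrite addr_gt0.
have S0 : 0 <= stieltjes alpha u t by exact: stieltjes_ge0.
case SE : (stieltjes alpha u t) S0 => [S| |] //; last first.
  by move=> _; rewrite gt0_muley ?lte_fin// leey.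
rewrite lee_fin => S0.
have ta0 : (0 < t `^ a)%R by rewrite powR_gt0.
have ta0E : 0 <= (t `^ a)%:E by rewrite lee_fin ltW.
have Sge := stieltjes_ge alpha1 pu t0 t0; rewrite maxxx SE in Sge.
have uge := below_ge pu niu t0.
case ut : (u t) => [lam| |]; last 2 first.
- have := le_trans (lee_wpmul2l ta0E uge) Sge.
  by rewrite ut gt0_mulye ?lte_fin// gt0_muley ?lte_fin.
- by have := rearr_ge0 mu setT f t; rewrite -/u ut.
have lam0 : (0 <= lam)%R by rewrite -lee_fin -ut rearr_ge0.
set h := fun y => mine (f y) lam%:E; set g := excess f lam.
have pg : mplus setT g by exact: mplus_excess.
have ph : mplus setT h.
  split => [|y Dy]; last by rewrite le_min f0.
  by apply: measurable_mine => //; exact: measurable_cst.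
have fhg : f = fun y => h y + g y.
  apply/funext => y; rewrite /h /g /excess; have [fl|fl] := leP (f y) lam%:E.
    by rewrite max_r ?adde0// sube_le0.
  by rewrite max_l ?sube_ge0 ?ltW// addeC subeK.
have hG : (t `^ a)%:E * \int[mu]_y g y <= S%:E.
  apply: le_trans Sge; apply: lee_wpmul2l => //.
  rewrite (integral_below_rearr (@sigma_finite_euclid R n) measurableT pf t0 ut).
  by rewrite leeDr// lee_fin mulr_ge0// ltW.
rewrite -EFinM; apply/lee_addgt0Pr => e e0; rewrite -EFinD.
have CS0 : (0 <= (C1 + C2) * S)%R by rewrite mulr_ge0// ltW.
have mIf : measurable_fun setT (I f) by exact: measurable_riesz.
have mIg : measurable_fun setT (I g) by exact: measurable_riesz pg.1.
apply/(rearr_leP mu measurableT t mIf); first by rewrite addr_ge0// ltW.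
have hw : (A / (1 + a) * t `^ a)%:E * \int[mu]_y g y < (C2 * S + e)%:E.
  apply: (@le_lt_trans _ _ (C2%:E * S%:E)).
    by rewrite -/C2 EFinM -muleA lee_wpmul2l// lee_fin ltW.
  by rewrite -EFinM lte_fin ltrDl.
apply: le_trans (riesz_weak_type pg t0 hw); apply: le_measure; rewrite ?inE.
- exact: (measurable_superlevel measurableT _ mIf).
- rewrite -[X in measurable X]setTI; apply: emeasurable_fun_o_infty => //.
- move=> x [_ /=]; rewrite gee0_abs ?riesz_ge0//; last by move=> y; exact: f0.
  have If : I f x = I h x + I g x by rewrite {1}fhg rieszD.
  rewrite If => hl; rewrite ltNge; apply/negP => Ig; move: hl; apply/negP.
  have Ih := riesz_truncated_le x pf t0 ut; rewrite -/h -/C1 -/u SE -EFinM in Ih.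
  rewrite -leNgt; apply: le_trans (leeD Ih Ig) _.
  by rewrite -EFinD lee_fin le_eqVlt; apply/orP; left; apply/eqP; ring.
Qed.

End kernel_superlevel.

Theorem rearr_riesz_le : exists C : R, (0 < C)%R /\
  forall f (t : R), mplus setT f -> (0 < t)%R ->
    rearr mu setT (I f) t <= C%:E * stieltjes alpha (rearr mu setT f) t.
Proof.
have [A [A0 hA]] := riesz_kernel_le hgamma.
exists (A / (1 + a) + A + A / (1 + a))%R; split.
  by rewrite !addr_gt0 ?divr_gt0.
by move=> f t pf t0; exact: rearr_riesz_le_of_kernel.
Qed.

End riesz_potential.

Local Close Scope ereal_scope.

(** * The optimal space *)

Local Open Scope ereal_scope.

Section optimal_space.
Context (R : realType) (n : nat) (gamma : R).
Hypothesis hgamma : (0 < gamma < n%:R)%R.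
Variables (rhoY : (euclid R n -> \bar R) -> \bar R)
  (rhoY' : (line R -> \bar R) -> \bar R).
Hypothesis hY : ri_norm (lebesgue_euclid R n) setT rhoY.
Hypothesis hY' : ri_norm (lebesgue_line R) (@halfline R) rhoY'.
Hypothesis rhoYE : forall f : euclid R n -> \bar R, measurable_fun setT f ->
  rhoY (fun x => `|f x|) = rhoY' (rearr (lebesgue_euclid R n) setT f).
Let alpha : R := (n%:R / gamma)%R.
Let n0 : (0 < n)%N := riesz_dim_gt0 hgamma.
Let alpha1 : (1 < alpha)%R := riesz_index_gt1 hgamma.
Notation mu := (lebesgue_euclid R n).
Notation leb1 := (lebesgue_line R).
Notation S := (stieltjes alpha).
Notation star f := (rearr mu setT f).
Notation sigma := (@sigma_norm R n gamma rhoY').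
Notation Ig := (@riesz R n gamma).
Implicit Types (f g : euclid R n -> \bar R) (u v : line R -> \bar R).

Let le_rhoY u v : mplus (@halfline R) u -> mplus (@halfline R) v ->
  (forall t : R, (0 < t)%R -> u t <= v t) -> rhoY' u <= rhoY' v.
Proof. by move=> pu pv uv; apply: (ri_mono hY') => //; exact: aeW. Qed.

Let eq_rhoY u v : mplus (@halfline R) u -> mplus (@halfline R) v ->
  (forall t : R, (0 < t)%R -> u t = v t) -> rhoY' u = rhoY' v.
Proof.
move=> pu pv uv; apply/eqP; rewrite eq_le; apply/andP.
by split; apply: le_rhoY => // t t0; rewrite uv.
Qed.

Let mplus_scale (c : R) u : (0 <= c)%R -> mplus (@halfline R) u ->
  mplus (@halfline R) (fun t => c%:E * u t).
Proof.
move=> c0 [mu u0]; split; first exact: measurable_funeM.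
by move=> t t0; rewrite mule_ge0 ?lee_fin ?u0.
Qed.

Let prearr f : mplus (@halfline R) (star f).
Proof. exact: mplus_rearr. Qed.

Let pabs f : measurable_fun setT f -> mplus setT (fun x : euclid R n => `|f x|).
Proof.
move=> mf; split => [|x _]; last exact: abse_ge0.
by apply: measurableT_comp mf; exact: abse_measurable.
Qed.

Let pS f : mplus (@halfline R) (S (star f)).
Proof. exact: mplus_stieltjes. Qed.

Lemma le_sigma_norm f g : mplus setT f -> mplus setT g ->
  {ae mu, forall x, setT x -> f x <= g x} -> sigma f <= sigma g.
Proof.
move=> pf pg fg; apply: (le_rhoY (pS f) (pS g)) => t t0.
apply: (le_stieltjes_pointwise alpha1 (prearr f) (prearr g) _ t0) => s s0.
apply: le_rearr_ae.
- exact: measurableT.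
- exact: pf.1.
- exact: pg.1.
- by apply: filterS fg => x h Dx; rewrite !gee0_abs ?pf.2 ?pg.2// h.
Qed.

(** The rearrangement of a sum is not dominated by the sum of the rearrangements,
    but its integrals over intervals ]0, r[ are, and the transform is monotone
    with respect to these. *)
Lemma sigma_norm_triangle f g : mplus setT f -> mplus setT g ->
  sigma (fun x => f x + g x) <= sigma f + sigma g.
Proof.
move=> pf pg; apply: le_trans (ri_triangle hY' (pS f) (pS g)).
have pfg : mplus (@halfline R) (fun s => (star f) s + (star g) s).
  split; first by apply: emeasurable_funD; exact: (prearr _).1.
  by move=> s s0; rewrite adde_ge0// rearr_ge0.
have pSfg : mplus (@halfline R) (fun t => S (star f) t + S (star g) t).
  split; first by apply: emeasurable_funD; exact: (pS _).1.
  by move=> t t0; rewrite adde_ge0// (pS _).2.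
apply: (le_rhoY (pS _) pSfg) => t t0.
rewrite -(stieltjesD alpha1 (prearr f) (prearr g) t0).
apply: (le_stieltjes alpha1 (prearr _) pfg _ t0) => r r0.
rewrite ge0_integralD; last 5 first.
- exact: measurable_below.
- by move=> s _; exact: rearr_ge0.
- by apply: measurable_belowS; exact: (prearr _).1.
- by move=> s _; exact: rearr_ge0.
- by apply: measurable_belowS; exact: (prearr _).1.
exact: (below_rearrD (@sigma_finite_euclid R n) measurableT pf pg r0).
Qed.

Lemma sigma_norm0 : sigma (fun x => 0) = 0.
Proof.
apply/(ri_eq0 hY' (pS _)).2/aeW => t t0.
have m0 : measurable_fun setT (fun _ : euclid R n => 0 : \bar R) by exact: measurable_cst.
rewrite (stieltjesE alpha1 (prearr _) t0) integral0_eq// => s s0.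
rewrite rearr_eq0 ?mule0// /distr.
rewrite (_ : _ `&` _ = set0) ?measure0 ?lee_fin; first exact: ltW.
by apply/seteqP; split => // x [_ /=]; rewrite normr0 ltxx.
Qed.

Lemma sigma_norm_scale f (l : R) : mplus setT f -> (0 <= l)%R ->
  sigma (fun x => l%:E * f x) = l%:E * sigma f.
Proof.
move=> pf; rewrite le_eqVlt => /predU1P[<-|l0].
  rewrite mul0e -[RHS]sigma_norm0; congr (sigma _).
  by apply/funext => x; rewrite mul0e.
have rE : star (fun x => l%:E * f x) = fun s => l%:E * (star f) s.
  by apply/funext => s; exact: (rearr_scale mu measurableT s pf.1 l0).
rewrite /sigma_norm rE -(ri_scale hY' (pS f) (ltW l0)); apply: eq_rhoY.
- exact: (mplus_stieltjes alpha1 (mplus_scale (ltW l0) (prearr f))).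
- exact: (mplus_scale (ltW l0) (pS f)).
- by move=> t t0; exact: (stieltjesZ alpha1 (ltW l0) (prearr f) t0).
Qed.

Lemma sigma_norm_fatou (f_ : nat -> euclid R n -> \bar R) f :
  (forall j, mplus setT (f_ j)) -> mplus setT f ->
  {ae mu, forall x, setT x -> nondecreasing_seq (fun j => f_ j x) /\
                             f_ j x @[j --> \oo] --> f x} ->
  nondecreasing_seq (fun j => sigma (f_ j)) /\
  sigma (f_ j) @[j --> \oo] --> sigma f.
Proof.
move=> pf_ pf ae_cv.
have cv s := cvg_rearr measurableT s pf_ pf ae_cv.
apply: (ri_fatou hY' (fun j => pS (f_ j)) (pS f)); apply: aeW => t t0; split.
  move=> i j ij.
  apply: (le_stieltjes_pointwise alpha1 (prearr _) (prearr _) _ t0) => s s0.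
  exact: (cv s).1.
by apply: (cvg_stieltjes alpha1 (fun j => prearr (f_ j)) (prearr f) _ _ t0) => s s0;
  [exact: (cv s).1|exact: (cv s).2].
Qed.

(** On ]0, r[ the transform is bounded below by a multiple of the integral of u
    over ]0, r[, and the characteristic function of ]0, r[ has positive norm. *)
Lemma below_le_rho_stieltjes (r : R) : (0 < r)%R -> exists C : R, (0 < C)%R /\
  forall u, mplus (@halfline R) u ->
    \int[leb1]_(s in below r%:E) u s <= C%:E * rhoY' (S u).
Proof.
move=> r0; pose chi (s : line R) : \bar R := (\1_(below r%:E) s)%:E.
have mb := @measurable_below R r%:E.
have bS : below r%:E `<=` @halfline R by move=> s [].
have pchi : mplus (@halfline R) chi.
  split => [|s _]; last by rewrite lee_fin.
  by apply/measurable_EFinP; exact: measurable_indic.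
have leb_b : leb1 (below r%:E) = r%:E by rewrite lebesgue_below// lee_fin ltW.
have k_oo : rhoY' chi < +oo by apply: (ri_indic hY' mb bS); rewrite leb_b ltry.
have k_ge0 := ri_ge0 hY' pchi.
have k_neq0 : rhoY' chi != 0.
  apply/eqP => /(ri_eq0 hY' pchi) [N [mN N0 hN]].
  have : leb1 (below r%:E) <= leb1 N.
    apply: le_measure; rewrite ?inE//.
    move=> s sb; apply: hN => /= /(_ (bS _ sb)) /eqP.
    by rewrite /chi eqe indicE mem_set// oner_eq0.
  by rewrite N0 leb_b lee_fin leNgt r0.
case kE : (rhoY' chi) k_oo k_ge0 k_neq0 => [k| |]// _.
rewrite lee_fin eqe => k0 kn0; have {k0 kn0}k0 : (0 < k)%R by rewrite lt0r kn0.
set a := (alpha^-1 - 1)%R.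
have ra0 : (0 < r `^ a)%R by rewrite powR_gt0.
exists (k * r `^ a)^-1%R; split; first by rewrite invr_gt0 mulr_gt0.
move=> u pu; have pSu := mplus_stieltjes alpha1 pu.
apply: lee_above.
  by rewrite mule_ge0 ?(ri_ge0 hY')// lee_fin invr_ge0 mulr_ge0 ?ltW.
(* real minorants l, as the integral of u may be infinite *)
move=> l l0 hl; rewrite lee_pdivlMl ?mulr_gt0//.
have rl0 : (0 <= r `^ a * l)%R by rewrite mulr_ge0 ?(ltW ra0).
rewrite -EFinM (_ : k * r `^ a * l = r `^ a * l * k)%R; last by ring.
rewrite EFinM -kE -(ri_scale hY' pchi rl0).
apply: (le_rhoY (mplus_scale rl0 pchi) pSu) => t t0; rewrite /chi indicE.
have [/set_mem[_]|_] := boolP (t \in below r%:E); last first.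
  by rewrite mule0; exact: pSu.2.
rewrite mule1 lte_fin => tr; apply: le_trans (stieltjes_ge alpha1 pu r0 t0).
by rewrite max_l ?(ltW tr)// EFinM lee_wpmul2l ?lee_fin ?(ltW ra0)// ltW.
Qed.

(** If sigma f = 0, then all integrals of f* over ]0, r[ vanish, hence f*(r) = 0
    for every r > 0. *)
Lemma sigma_norm_eq0 f : mplus setT f ->
  (sigma f = 0 <-> {ae mu, forall x, setT x -> f x = 0}).
Proof.
move=> pf; split => [sf0|f0].
  have distr0 : distr mu setT f 0 <= 0%:E.
    apply/lee_addgt0Pr => r r0; rewrite -EFinD add0r.
    apply/(rearr_leP mu measurableT r pf.1 (lexx 0%R)).
    have [C [C0 hC]] := below_le_rho_stieltjes r0.
    have h := le_trans (below_ge (prearr f)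
      (fun s t _ => @rearr_nonincreasing _ _ _ mu setT f s t) r0) (hC _ (prearr f)).
    have : (star f) r * r%:E <= 0.
      by apply: (le_trans h); rewrite [rhoY' _]sf0 mule0.
    by rewrite pmule_lle0// lte_fin.
  exists (setT `&` [set x | 0%:E < `|f x|]); split.
  - exact: (measurable_superlevel measurableT _ pf.1).
  - by apply/eqP; rewrite eq_le measure_ge0 andbT.
  - move=> x /= h; split => //=; rewrite gee0_abs ?pf.2// lt0e pf.2// andbT.
    by apply/eqP => fx; apply: h.
have p0 : mplus [set: euclid R n] (fun _ => 0 : \bar R).
  by split => //; exact: measurable_cst.
apply/eqP; rewrite eq_le (ri_ge0 hY' (pS f)) andbT -sigma_norm0.
apply: (le_sigma_norm pf p0).
by apply: filterS f0 => x h /h ->.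
Qed.

(** The rearrangement of the characteristic function of E is at most 1 and vanishes
    from the measure of E on; adding 1 makes the bound r of its support positive
    when E is a null set. *)
Lemma sigma_norm_indic (E : set (euclid R n)) :
  ri_space (@halfline R) rhoY' (@xi R alpha) ->
  measurable E -> mu E < +oo -> sigma (fun x => (\1_E x)%:E) < +oo.
Proof.
move=> [mxi xi_oo] mE Eoo.
have fE : mu E \is a fin_num by rewrite ge0_fin_numE// measure_ge0.
pose r : R := (fine (mu E) + 1)%R.
have E0 : (0 <= fine (mu E))%R by rewrite fine_ge0// measure_ge0.
have r0 : (0 < r)%R by rewrite ltr_wpDl.
have [C [C0 hC]] := stieltjes_le_xi alpha1 r0.
have pxi : mplus (@halfline R) (@xi R alpha).
  by split => // t t0; rewrite lee_fin powR_ge0.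
have xiE : (fun t : line R => `|xi alpha t|) = @xi R alpha.
  by apply/funext => t; rewrite gee0_abs// lee_fin powR_ge0.
rewrite xiE in xi_oo.
set f := fun x : euclid R n => (\1_E x)%:E.
have mf : measurable_fun setT f.
  by apply/measurable_EFinP; exact: measurable_indic.
apply: (@le_lt_trans _ _ (C%:E * rhoY' (@xi R alpha))); last first.
  by rewrite lte_mul_pinfty// lee_fin ltW.
rewrite -(ri_scale hY' pxi (ltW C0)).
apply: (le_rhoY (pS f) (mplus_scale (ltW C0) pxi)); apply: hC => //.
- move=> s s0; apply/(rearr_leP mu measurableT s mf ler01); rewrite /distr.
  rewrite (_ : _ `&` _ = set0) ?measure0 ?lee_fin ?(ltW s0)//.
  apply/seteqP; split => // x [_ /=]; rewrite lte_fin indicE ger0_norm//.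
  by rewrite ltNge lern1 leq_b1.
- move=> s rs; apply: (rearr_eq0 measurableT mf).
  apply: (@le_trans _ _ (mu E)).
    apply: le_measure; rewrite ?inE//.
      exact: (measurable_superlevel measurableT _ mf).
    move=> x [_ /=]; rewrite lte_fin indicE; have [/set_mem//|_] := boolP (x \in E).
    by rewrite normr0 ltxx.
  by rewrite -(fineK fE) lee_fin (le_trans _ rs)// lerDl.
Qed.

Lemma sigma_norm_local (E : set (euclid R n)) : measurable E -> mu E < +oo ->
  exists C : R, (0 < C)%R /\
    forall f, mplus setT f -> \int[mu]_(x in E) f x <= C%:E * sigma f.
Proof.
move=> mE Eoo.
have fE : mu E \is a fin_num by rewrite ge0_fin_numE// measure_ge0.
pose r : R := (fine (mu E) + 1)%R.
have E0 : (0 <= fine (mu E))%R by rewrite fine_ge0// measure_ge0.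
have r0 : (0 < r)%R by rewrite ltr_wpDl.
have [C [C0 hC]] := below_le_rho_stieltjes r0.
exists C; split => // f pf; apply: le_trans (hC _ (prearr f)).
apply: (integral_le_below_rearr (@sigma_finite_euclid R n) measurableT mE
  (@subsetT _ _) pf r0).
by rewrite -(fineK fE) lee_fin lerDl.
Qed.

Theorem sigma_norm_ri : ri_space (@halfline R) rhoY' (@xi R alpha) ->
  ri_norm mu setT sigma.
Proof.
move=> hA; split.
- by move=> f _; exact: (ri_ge0 hY' (pS f)).
- exact: sigma_norm_eq0.
- exact: sigma_norm_scale.
- exact: sigma_norm_triangle.
- exact: le_sigma_norm.
- exact: sigma_norm_fatou.
- by move=> E mE _; exact: sigma_norm_indic.
- by move=> E mE _; exact: sigma_norm_local.
- move=> f g _ _ fg; apply: (eq_rhoY (pS f) (pS g)) => t t0; apply/eqP.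
  by rewrite eq_le; apply/andP; split;
    apply: (le_stieltjes_pointwise alpha1 (prearr _) (prearr _) _ t0) => s s0;
    rewrite fg.
Qed.

Theorem riesz_bounded_sigma : bounded_op setT sigma rhoY Ig.
Proof.
have [C [C0 hC]] := rearr_riesz_le hgamma.
exists C; split => [|f [mf _]]; first exact: C0.
have pf := pabs mf.
have mI : measurable_fun setT (Ig f) by exact: measurable_riesz.
have mIa : measurable_fun setT (Ig (fun x => `|f x|)).
  exact: measurable_riesz pf.1.
split; [exact: mI|rewrite (rhoYE mI)].
rewrite -(ri_scale hY' (pS (fun x => `|f x|)) (ltW C0)).
apply: (le_rhoY (prearr _) (mplus_scale (ltW C0) (pS _))) => t t0.
apply: le_trans (hC _ _ pf t0).
apply: (le_rearr_ae _ measurableT mI mIa); apply: aeW => x _.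
by apply: le_trans (abse_riesz_le hgamma x mf) _; exact: lee_abs.
Qed.

(** The function (S u) o gauge is equimeasurable with S u, so the norm of S u on
    the half-line is its norm in Y, and it lies below a multiple of the potential
    of u o gauge. *)
Lemma rho_stieltjes_le_riesz : exists B : R, (0 < B)%R /\
  forall u, mplus (@halfline R) u ->
    (forall s t : R, (0 < s)%R -> (s <= t)%R -> u t <= u s) ->
    B%:E * rhoY' (S u) <= rhoY (fun x => `|Ig (gcomp u) x|).
Proof.
have [B [B0 hB]] := stieltjes_le_riesz hgamma.
exists B; split => [|u pu niu]; first exact: B0.
have pSu := mplus_stieltjes alpha1 pu.
have niSu (s t : R) : (0 < s)%R -> (s <= t)%R -> S u t <= S u s.
  exact: stieltjes_nonincreasing.
have [mG G0] := mplus_gcomp n0 pSu niSu.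
have pu' := mplus_gcomp n0 pu niu.
have -> : rhoY' (S u) = rhoY (gcomp (S u)).
  have -> : gcomp (n := n) (S u) = fun x => `|gcomp (S u) x|.
    by apply/funext => x; rewrite gee0_abs// G0.
  rewrite (rhoYE mG); apply: (ri_equimeas hY' pSu (prearr _)) => t t0.
  apply: eq_rearr => l l0.
  by rewrite (distr_rearr mu measurableT mG (ltW l0)) (distr_gcomp n0 pSu niSu (ltW l0)).
have pG : mplus setT (gcomp (n := n) (S u)) := conj mG G0.
rewrite -(ri_scale hY pG (ltW B0)).
have mI : measurable_fun setT (Ig (gcomp u)) by exact: measurable_riesz pu'.1.
apply: (ri_mono hY).
- by split; [exact: measurable_funeM|move=> x _; rewrite mule_ge0 ?lee_fin ?(ltW B0) ?G0].
- exact: pabs.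
apply: aeW => x _; apply: le_trans (lee_abs _).
rewrite {1}/gcomp; case: ifPn => [gx|_]; first exact: hB.
by rewrite mule0; apply: (riesz_ge0 hgamma) => y; exact: pu'.2.
Qed.

(** The function f* o gauge has the norm of f in Z, because it is equimeasurable
    with f, and its potential has the largest norm in Y up to a factor. *)
Theorem sigma_norm_optimal (rhoZ : (euclid R n -> \bar R) -> \bar R) :
  ri_norm mu setT rhoZ -> bounded_op setT rhoZ rhoY Ig ->
  embedded setT rhoZ sigma.
Proof.
move=> hZ [C [C0 hC]]; have [B [B0 hB]] := rho_stieltjes_le_riesz.
exists (C / B)%R; split; first by rewrite divr_gt0.
move=> f [mf Zf]; split; first exact: mf.
have pf := pabs mf.
set u := star (fun x => `|f x|).
have pu : mplus (@halfline R) u by exact: prearr.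
have niu (s t : R) : (0 < s)%R -> (s <= t)%R -> u t <= u s.
  by move=> _; exact: rearr_nonincreasing.
have pF := mplus_gcomp n0 pu niu.
have FE : (fun x => `|gcomp (n := n) u x|) = gcomp u.
  by apply/funext => x; rewrite gee0_abs// pF.2.
have ZF : rhoZ (gcomp u) = rhoZ (fun x => `|f x|).
  apply: (ri_equimeas hZ pF pf) => t t0; apply: eq_rearr => l l0.
  by rewrite (distr_gcomp n0 pu niu (ltW l0)) (distr_rearr mu measurableT pf.1 (ltW l0)).
have [_ hF] : measurable_fun setT (Ig (gcomp u)) /\ rhoY (fun x => `|Ig (gcomp u) x|) <=
    C%:E * rhoZ (fun x => `|gcomp (n := n) u x|).
  by apply: hC; split; [exact: pF.1|rewrite FE ZF].
have := le_trans (hB u pu niu) hF; rewrite FE ZF => h.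
by rewrite mulrC EFinM -muleA lee_pdivlMl.
Qed.

(** By optimality sigma is finite on the characteristic function of the unit cube,
    and the transform of the rearrangement of that function dominates xi. *)
Theorem riesz_bounded_xi (rhoX : (euclid R n -> \bar R) -> \bar R) :
  ri_norm mu setT rhoX -> bounded_op setT rhoX rhoY Ig ->
  ri_space (@halfline R) rhoY' (@xi R alpha).
Proof.
move=> hX bX; have [C [C0 hC]] := sigma_norm_optimal hX bX.
have a0 : (alpha^-1 - 1 < 0)%R by rewrite subr_lt0 invf_lt1// (lt_trans ltr01).
have pxi : mplus (@halfline R) (@xi R alpha).
  split => [|t t0]; last by rewrite lee_fin powR_ge0.
  apply: measurable_fun_nonincreasing => s t s0 st; rewrite lee_fin.
  by apply: (powR_neg_le a0); rewrite ?addr_gt0// lerD2r.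
split; first exact: pxi.1.
have -> : (fun t : line R => `|xi alpha t|) = @xi R alpha.
  by apply/funext => t; rewrite gee0_abs// lee_fin powR_ge0.
pose E : set (euclid R n) := [set y | (gauge (vsub (origin R n) y) < 1)%R].
have mE : measurable E by exact: measurable_gauge_vsub.
have muE : mu E = 1 by exact: measure_gauge_vsub.
pose f : euclid R n -> \bar R := fun x => (\1_E x)%:E.
have mf : measurable_fun setT f.
  by apply/measurable_EFinP; exact: measurable_indic.
have fE : (fun x => `|f x|) = f.
  by apply/funext => x; rewrite gee0_abs// lee_fin.
have fX : rhoX f < +oo.
  by apply: (ri_indic hX mE (@subsetT _ _)); rewrite [X in X < _]muE ltry.
have [_ hs] : measurable_fun setT f /\ sigma (fun x => `|f x|) <= C%:E * rhoX (fun x => `|f x|).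
  by apply: hC; split; [exact: mf|rewrite fE].
rewrite fE in hs.
apply: (@le_lt_trans _ _ (sigma f)); last first.
  by apply: le_lt_trans hs _; rewrite lte_mul_pinfty// ?lee_fin ?(ltW C0)// (ri_ge0 hX).
apply: (le_rhoY pxi (pS f)) => t t0.
apply: (xi_le_stieltjes alpha1 (prearr f) _ t0) => s /andP[s0 s1].
apply: lee_above; first exact: rearr_ge0.
move=> l l0; rewrite lte_fin => l1; apply/ltW/(rearr_gtP mu measurableT s mf l0).
rewrite /distr (_ : _ `&` _ = E) ?muE ?lte_fin//.
apply/seteqP; split => x.
  move=> [_ /=]; rewrite lte_fin indicE; have [/set_mem//|_] := boolP (x \in E).
  by rewrite normr0 ltNge l0.
by move=> xE; split => //=; rewrite lte_fin indicE mem_set// normr1.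
Qed.

End optimal_space.

Local Close Scope ereal_scope.

Theorem theorem6p4 (R : realType) (n : nat) (gamma : R)
    (hgamma : 0 < gamma < n%:R)
    (rhoY : (euclid R n -> \bar R) -> \bar R)
    (hY : ri_norm (lebesgue_euclid R n) setT rhoY)
    (rhoY' : (line R -> \bar R) -> \bar R)
    (hY' : representation_norm rhoY rhoY') :
  (ri_space (@halfline R) rhoY' (@xi R (n%:R / gamma)) ->
     [/\ ri_norm (lebesgue_euclid R n) setT (@sigma_norm R n gamma rhoY'),
         bounded_op setT (@sigma_norm R n gamma rhoY') rhoY (@riesz R n gamma)
       & forall rhoZ : (euclid R n -> \bar R) -> \bar R,
           ri_norm (lebesgue_euclid R n) setT rhoZ ->
           bounded_op setT rhoZ rhoY (@riesz R n gamma) ->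
           embedded setT rhoZ (@sigma_norm R n gamma rhoY')])
  /\
  (~ ri_space (@halfline R) rhoY' (@xi R (n%:R / gamma)) ->
     ~ exists rhoX : (euclid R n -> \bar R) -> \bar R,
         ri_norm (lebesgue_euclid R n) setT rhoX /\
         bounded_op setT rhoX rhoY (@riesz R n gamma)).
Proof.
have [hR rhoYE] := hY'; split => [hA|nA [rhoX [hX bX]]].
  split.
  - exact: sigma_norm_ri.
  - exact: riesz_bounded_sigma.
  - by move=> rhoZ; exact: sigma_norm_optimal.
apply: nA; exact: (riesz_bounded_xi hgamma hY hR rhoYE hX bX).
Qed.
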